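(* Let $n\ge2$ and let $(Z,Z')$ be a point of the graph variety $\Gamma_{\Psi_n}\subset Y_d\times Y_{d^n}$ of the rational map $\Psi_n:Y_d\dashrightarrow Y_{d^n}$ induced by $n$-fold iteration. If $[F]\in\overline{\mathrm{Rat}}_d\setminus I(d)$ satisfies $[F]\in\mathrm{supp}\,Z$, then $\Phi_n([F])\in\mathrm{supp}\,Z'$.
   Context: $k$ is an algebraically closed field of characteristic $0$, $d\ge2$, $G=\mathrm{PGL}_2$ over $k$. $\overline{\mathrm{Rat}}_d:=\mathbb{P}(H^0(\mathbb{P}^1\times\mathbb{P}^1,\mathcal{O}(d,1)))\simeq\mathbb{P}^{2d+1}$; a point $[F]$ is the class of a nonzero form $F=y_1f_0(x)-y_0f_1(x)$ with $f_0,f_1$ binary forms of degree $d$; the open set $\mathrm{Rat}_d$ where $f_0,f_1$ are coprime is the space of degree-$d$ rational maps $x\mapsto[f_0(x):f_1(x)]$. $G$ acts by (the extension of) conjugation. Writing $f_j=hg_j$ with $h=\gcd(f_0,f_1)$, $F^{\mathrm{main}}$ is the (possibly constant) map $[g_0:g_1]$ and $\mathrm{depth}_P F:=\mathrm{ord}_P h$. $\Phi_n:\overline{\mathrm{Rat}}_d\dashrightarrow\overline{\mathrm{Rat}}_{d^n}$ is the rational map extending $\varphi\mapsto\varphi^n$ ($n$-fold composition) on $\mathrm{Rat}_d$. Its indeterminacy locus (independent of $n$, by a known result of DeMarco) is $$I(d)=\{F\in\overline{\mathrm{Rat}}_d\mid F^{\mathrm{main}}\text{ is a constant map with value }c,\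 \mathrm{depth}_cF\ge1\}.$$ Chow quotient: let $X$ be a projective variety with a generically free action of $G$. For $x\in X$ with finite stabilizer the orbit cycle is $\overline{G\cdot x}:=(\#\mathrm{stab}_G(x))\overline{G\cdot x}_{\mathrm{red}}$. Let $U\subset X$ be a $G$-invariant dense open subset on which the action is free and the orbit closures form an algebraic family; $X/\!/_{Ch}G$ is the closure in $\mathrm{Chow}(X)$ of the image of $U\to\mathrm{Chow}(X)$, $x\mapsto\overline{G\cdot x}$. Thus a point $Z$ of it is an effective cycle with support $\mathrm{supp}\,Z\subset X$. Put $Y_d:=\overline{\mathrm{Rat}}_d/\!/_{Ch}G$. The rational map $\Psi_n:Y_d\dashrightarrow Y_{d^n}$ is the one with $\Psi_n(\overline{G\cdot[F]})=\overline{G\cdot\Phi_n([F])}$ for generic $[F]$; its graph variety $\Gamma_{\Psi_n}$ is the closure in $Y_d\times Y_{d^n}$ of the graph of $\Psi_n$ on a dense open set of definition. *)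

(* Defs.v *)
From HB Require Import structures.
From mathcomp Require Import all_boot all_order all_algebra.
From mathcomp Require Import mpoly.

Set Implicit Arguments.
Unset Strict Implicit.
Unset Printing Implicit Defensive.

Import GRing.Theory.
Local Open Scope ring_scope.

(* Classical projective geometry over k.  A point of P^(N-1) is given by a
   nonzero row vector of homogeneous coordinates in k^N, two vectors being the
   same point when they are [peq]; a subset of P^(N-1) is a predicate on
   vectors, which holds of nonzero vectors only and is stable under [peq]
   (both are automatic for closed sets and for relatively open subsets of
   closed sets). *)

Definition peq (k : fieldType) (N : nat) (x y : 'rV[k]_N) : Prop :=
  [/\ x != 0, y != 0 & exists2 c : k, c != 0 & x = c *: y].

Definition pset (k : fieldType) (N : nat) := 'rV[k]_N -> Prop.

Definition psub (k : fieldType) (N : nat) (A B : pset k N) : Prop :=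
  forall x, A x -> B x.

Definition peval (k : fieldType) (N : nat) (Q : {mpoly k[N]}) (x : 'rV[k]_N)
  : k := Q.@[x ord0].

Definition pspace (k : fieldType) (N : nat) : pset k N := fun x => x != 0.

Definition pclosed (k : fieldType) (N : nat) (V : pset k N) : Prop :=
  exists S : {mpoly k[N]} -> Prop,
    (forall Q, S Q -> exists e : nat, Q \is e.-homog) /\
    (forall x, V x <-> x != 0 /\ forall Q, S Q -> peval Q x = 0).

Definition pclosure (k : fieldType) (N : nat) (A : pset k N) : pset k N :=
  fun x => forall V, pclosed V -> psub A V -> V x.

Definition popen_in (k : fieldType) (N : nat) (Y D : pset k N) : Prop :=
  exists2 C, pclosed C & forall x, D x <-> Y x /\ ~ C x.

Definition dense_open_in (k : fieldType) (N : nat) (Y D : pset k N) : Prop :=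
  popen_in Y D /\ psub Y (pclosure D).

Definition bihomog (k : fieldType) (a b e1 e2 : nat) (Q : {mpoly k[a + b]})
  : Prop :=
  forall m, m \in msupp Q ->
    (\sum_(i < a) m (lshift b i))%N = e1 /\ (\sum_(j < b) m (rshift a j))%N = e2.

Definition pset2 (k : fieldType) (a b : nat) := 'rV[k]_a -> 'rV[k]_b -> Prop.

Definition pclosed2 (k : fieldType) (a b : nat) (V : pset2 k a b) : Prop :=
  exists S : {mpoly k[a + b]} -> Prop,
    (forall Q, S Q -> exists e1 e2 : nat, bihomog e1 e2 Q) /\
    (forall x y, V x y <->
       [/\ x != 0, y != 0 & forall Q, S Q -> peval Q (row_mx x y) = 0]).

Definition pclosure2 (k : fieldType) (a b : nat) (A : pset2 k a b)
  : pset2 k a b :=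
  fun x y => forall V, pclosed2 V -> (forall u v, A u v -> V u v) -> V x y.

(* A morphism from A to P^(N'-1), locally given by forms of the same degree. *)
Definition forms_at (k : fieldType) (N N' : nat) (Q : 'I_N' -> {mpoly k[N]})
  (x : 'rV[k]_N) : 'rV[k]_N' := \row_j peval (Q j) x.

Definition regular_on (k : fieldType) (N N' : nat) (A : pset k N)
  (f : 'rV[k]_N -> 'rV[k]_N') : Prop :=
  forall x, A x -> exists (Q : 'I_N' -> {mpoly k[N]}) (e : nat),
    [/\ forall j, Q j \is e.-homog,
        forms_at Q x != 0 &
        forall y, A y -> forms_at Q y != 0 -> peq (f y) (forms_at Q y)].

Definition pirreducible (k : fieldType) (N : nat) (V : pset k N) : Prop :=
  [/\ pclosed V, exists x, V x &
      forall C1 C2, pclosed C1 -> pclosed C2 ->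
        (forall x, V x -> C1 x \/ C2 x) -> psub V C1 \/ psub V C2].

Definition has_chain (k : fieldType) (N : nat) (V : pset k N) (r : nat) : Prop :=
  exists W : nat -> pset k N,
    (forall i, (i <= r)%N -> pirreducible (W i) /\ psub (W i) V) /\
    (forall i, (i < r)%N -> psub (W i) (W i.+1) /\ ~ psub (W i.+1) (W i)).

Definition pdim (k : fieldType) (N : nat) (V : pset k N) (r : nat) : Prop :=
  has_chain V r /\ ~ has_chain V r.+1.

Record alg_cycle (k : fieldType) (N : nat) := AlgCycle {
  cncomp : nat;
  cmult : 'I_cncomp -> nat;
  ccomp : 'I_cncomp -> pset k N
}.
Arguments cmult {k N} a i.
Arguments ccomp {k N} a i x.

Definition effective_cycle (k : fieldType) (N r : nat) (Z : alg_cycle k N) : Prop :=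
  (forall i, [/\ (0 < cmult Z i)%N, pirreducible (ccomp Z i)
               & pdim (ccomp Z i) r]) /\
  (forall i j, (forall x, ccomp Z i x <-> ccomp Z j x) -> i = j).

Definition csupp (k : fieldType) (N : nat) (Z : alg_cycle k N) : pset k N :=
  fun x => exists i, ccomp Z i x.

(* Chow coordinates.  A form in r + 1 groups of N variables is evaluated at an
   (r + 1) x N matrix, whose rows are the coefficient vectors of r + 1
   hyperplanes. *)
Definition meval_mx (k : fieldType) (r N : nat) (R : {mpoly k[r.+1 * N]})
  (u : 'M[k]_(r.+1, N)) : k := peval R (mxvec u).

Definition irreducible_mpoly (k : fieldType) (M : nat) (R : {mpoly k[M]})
  : Prop :=
  [/\ R != 0, R \isn't a GRing.unit &
      forall A B, R = A * B -> A \is a GRing.unit \/ B \is a GRing.unit].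

Definition is_chow_form (k : fieldType) (r N : nat) (V : pset k N)
  (R : {mpoly k[r.+1 * N]}) : Prop :=
  irreducible_mpoly R /\
  forall u : 'M[k]_(r.+1, N),
    meval_mx R u = 0 <->
    exists2 x, V x & forall i, \sum_(j < N) u i j * x ord0 j = 0.

Definition chow_homog (k : fieldType) (r N e : nat) (R : {mpoly k[r.+1 * N]})
  : Prop :=
  forall m, m \in msupp R ->
    forall i : 'I_r.+1, (\sum_(j < N) m (mxvec_index i j))%N = e.

(* All monomials of degree at most (r + 1) e are listed; those which are not of
   degree e in each group of variables have coefficient 0 in a Chow form. *)
Definition chow_monom (r N e : nat) : finType :=
  'X_{1..(r.+1 * N) < (r.+1 * e).+1}.

Definition chow_ncoord (r N e : nat) : nat := #|chow_monom r N e|.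

Definition coef_row (k : fieldType) (r N e : nat) (R : {mpoly k[r.+1 * N]})
  : 'rV[k]_(chow_ncoord r N e) :=
  \row_i R@_(bmnm (enum_val (A := chow_monom r N e) i)).

(* p is the point of the Chow variety of P^(N-1) defined by Z, an effective
   cycle of dimension r and degree e (the degree of a cycle is the degree of
   its Chow form in each group of variables). *)
Definition chow_point (k : fieldType) (r N e : nat) (Z : alg_cycle k N)
  (p : 'rV[k]_(chow_ncoord r N e)) : Prop :=
  effective_cycle r Z /\
  exists (Rs : 'I_(cncomp Z) -> {mpoly k[r.+1 * N]}),
    [/\ forall i, is_chow_form (ccomp Z i) (Rs i),
        chow_homog e (\prod_i Rs i ^+ cmult Z i) &
        peq p (coef_row e (\prod_i Rs i ^+ cmult Z i))].

Definition chow_variety (k : fieldType) (r N e : nat)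
  : pset k (chow_ncoord r N e) := fun p => exists Z : alg_cycle k N, chow_point Z p.

(* A point [F] of Rat_d-bar is given by the coefficients of the pair (f0, f1)
   of binary forms of degree d in ('X_0, 'X_1), those of f0 coming first. *)

Definition ratdim (d : nat) : nat := (d.+1 + d.+1)%N.

Definition bmonom (d i : nat) : 'X_{1..2} :=
  (U_(ord0) *+ (d - i) + U_(ord_max) *+ i)%MM.

Definition bform (k : fieldType) (d : nat) (a : 'rV[k]_d.+1) : {mpoly k[2]} :=
  \sum_(i < d.+1) a ord0 i *: 'X_[bmonom d i].

Definition brow (k : fieldType) (d : nat) (p : {mpoly k[2]}) : 'rV[k]_d.+1 :=
  \row_(i < d.+1) p@_(bmonom d i).

Definition rform (k : fieldType) (d : nat) (F : 'rV[k]_(ratdim d)) (j : 'I_2)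
  : {mpoly k[2]} :=
  if j == ord0 then bform (lsubmx F) else bform (rsubmx F).

Definition coprime_forms (k : fieldType) (g : 'I_2 -> {mpoly k[2]}) : Prop :=
  forall h : {mpoly k[2]}, (forall j, exists q, g j = h * q) ->
    h \is a GRing.unit.

Definition Rat (k : fieldType) (d : nat) : pset k (ratdim d) :=
  fun F => coprime_forms (rform F).

Definition eval_pair (k : fieldType) (g : 'I_2 -> {mpoly k[2]}) (x : 'rV[k]_2)
  : 'rV[k]_2 := \row_j peval (g j) x.

Definition conj_act (k : fieldType) (d : nat) (g : 'M[k]_2)
  (F : 'rV[k]_(ratdim d)) : 'rV[k]_(ratdim d) :=
  let ginv := [tuple \sum_(j < 2) invmx g i j *: ('X_j : {mpoly k[2]}) | i < 2] in
  let f i := \sum_(j < 2) g i j *: (rform F j \mPo ginv) in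
  row_mx (brow d (f ord0)) (brow d (f ord_max)).

Definition stabilizes (k : fieldType) (d : nat) (F : 'rV[k]_(ratdim d))
  (g : 'M[k]_2) : Prop := g \in unitmx /\ peq (conj_act g F) F.

Definition pgl_eq (k : fieldType) (g h : 'M[k]_2) : Prop :=
  exists2 c : k, c != 0 & g = c *: h.

Definition stab_order (k : fieldType) (d : nat) (F : 'rV[k]_(ratdim d))
  (s : nat) : Prop :=
  exists t : 'I_s -> 'M[k]_2,
    [/\ forall i, stabilizes F (t i),
        forall i j, pgl_eq (t i) (t j) -> i = j &
        forall g, stabilizes F g -> exists i, pgl_eq g (t i)].

Definition pgl_orbit (k : fieldType) (d : nat) (F : 'rV[k]_(ratdim d))
  : pset k (ratdim d) :=
  fun F' => exists2 g : 'M[k]_2, g \in unitmx & peq F' (conj_act g F).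

Definition is_orbit_cycle (k : fieldType) (d : nat) (F : 'rV[k]_(ratdim d))
  (Z : alg_cycle k (ratdim d)) : Prop :=
  exists2 s, stab_order F s &
    Z = @AlgCycle k (ratdim d) 1 (fun=> s) (fun=> pclosure (pgl_orbit F)).

(* p is the point of the Chow variety defined by the orbit cycle of [F];
   orbits with finite stabilizer have dimension 3. *)
Definition orbit_chow_point (k : fieldType) (d e : nat)
  (F : 'rV[k]_(ratdim d)) (p : 'rV[k]_(chow_ncoord 3 (ratdim d) e)) : Prop :=
  exists2 Z, is_orbit_cycle F Z & chow_point Z p.

(* U is a G-invariant dense open subset on which the action is free and the
   orbit closures form an algebraic family, i.e. the orbit cycles of the points
   of U define a morphism from U to the component of the Chow variety of cycles
   of dimension 3 and some degree e. *)
Definition free_family (k : fieldType) (d e : nat) (U : pset k (ratdim d))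
  : Prop :=
  [/\ dense_open_in (@pspace k (ratdim d)) U,
      forall F g, U F -> g \in unitmx -> U (conj_act g F),
      forall F g, U F -> stabilizes F g -> pgl_eq g 1%:M &
      exists2 f, regular_on U f &
        forall F, U F -> orbit_chow_point (e := e) F (f F)].

Definition chow_quotient (k : fieldType) (d e : nat) (U : pset k (ratdim d))
  : pset k (chow_ncoord 3 (ratdim d) e) :=
  fun p => chow_variety p /\
    pclosure (fun q => exists2 F, U F & orbit_chow_point F q) p.

(* F' is the n-fold composition of F, both being rational maps P^1 -> P^1. *)
Definition is_iterate (k : fieldType) (d n : nat) (F : 'rV[k]_(ratdim d))
  (F' : 'rV[k]_(ratdim (d ^ n))) : Prop :=
  [/\ Rat F, Rat F' &
      forall x, x != 0 ->
        peq (eval_pair (rform F') x) (iter n (eval_pair (rform F)) x)].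

(* The rational map extending n-fold composition of the elements of Rat_d is
   regular at [F], with value [F']: near [F] it is given by forms Q_j of the
   same degree. *)
Definition Phi_value (k : fieldType) (d n : nat) (F : 'rV[k]_(ratdim d))
  (F' : 'rV[k]_(ratdim (d ^ n))) : Prop :=
  exists (Q : 'I_(ratdim (d ^ n)) -> {mpoly k[ratdim d]}) (e : nat),
    [/\ forall j, Q j \is e.-homog,
        peq F' (forms_at Q F) &
        forall E, Rat E -> forms_at Q E != 0 -> is_iterate E (forms_at Q E)].

Definition gcd_decomp (k : fieldType) (d : nat) (F : 'rV[k]_(ratdim d))
  (h : {mpoly k[2]}) (g : 'I_2 -> {mpoly k[2]}) : Prop :=
  (forall j, rform F j = h * g j) /\ coprime_forms g.

Definition constant_map (k : fieldType) (g : 'I_2 -> {mpoly k[2]})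
  (c : 'rV[k]_2) : Prop := forall x, x != 0 -> peq (eval_pair g x) c.

Definition linear_form_at (k : fieldType) (P : 'rV[k]_2) : {mpoly k[2]} :=
  P ord0 ord_max *: 'X_ord0 - P ord0 ord0 *: 'X_ord_max.

Definition is_ord (k : fieldType) (P : 'rV[k]_2) (h : {mpoly k[2]}) (m : nat)
  : Prop :=
  (exists q, h = linear_form_at P ^+ m * q) /\
  ~ (exists q, h = linear_form_at P ^+ m.+1 * q).

Definition indeterminacy_locus (k : fieldType) (d : nat) : pset k (ratdim d) :=
  fun F => F != 0 /\
    exists (h : {mpoly k[2]}) (g : 'I_2 -> {mpoly k[2]}) (c : 'rV[k]_2) (m : nat),
      [/\ gcd_decomp F h g, constant_map g c, is_ord c h m & (1 <= m)%N].

(* (D, Psi) represents the rational map Psi_n from Y_d to Y_(d^n). *)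
Definition represents_Psi (k : fieldType) (d n e e' : nat)
  (U : pset k (ratdim d)) (U' : pset k (ratdim (d ^ n)))
  (D : pset k (chow_ncoord 3 (ratdim d) e))
  (Psi : 'rV[k]_(chow_ncoord 3 (ratdim d) e) ->
         'rV[k]_(chow_ncoord 3 (ratdim (d ^ n)) e')) : Prop :=
  [/\ dense_open_in (chow_quotient (e := e) U) D,
      regular_on D Psi,
      forall p, D p -> chow_quotient (e := e') U' (Psi p) &
      exists2 W, dense_open_in (@pspace k (ratdim d)) W &
        forall F, W F -> exists F' p p',
          [/\ Phi_value F F', orbit_chow_point F p,
              orbit_chow_point F' p', D p & peq (Psi p) p']].

Definition graph_variety (k : fieldType) (d n e e' : nat)
  (U : pset k (ratdim d)) (U' : pset k (ratdim (d ^ n)))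
  (D : pset k (chow_ncoord 3 (ratdim d) e))
  (Psi : 'rV[k]_(chow_ncoord 3 (ratdim d) e) ->
         'rV[k]_(chow_ncoord 3 (ratdim (d ^ n)) e'))
  : pset2 k (chow_ncoord 3 (ratdim d) e) (chow_ncoord 3 (ratdim (d ^ n)) e') :=
  fun p p' =>
    [/\ chow_quotient (e := e) U p, chow_quotient (e := e') U' p' &
        pclosure2 (fun q q' => D q /\ peq (Psi q) q') p p'].

(* Main.v *)
(* Let Q be the coefficient forms of the n-th homogeneous iterate; they do not
   vanish at F outside I(d).  Suppose Q(F) is not in supp Z'.  Then there are four
   hyperplanes through Q(F) that miss supp Z'; letting them move with x so as to
   contain Q(x) turns the Chow form of q' into a form B_q'(x), which is nonzero at
   F for q' = Z' and vanishes on supp q whenever q, q' are the orbit cycles of E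
   and Phi_n(E).  Choose three hyperplanes through F such that the Chow form of Z
   restricts to a nonzero form L_Z in the fourth one.  For an orbit cycle q, L_q
   is a product of linear forms l_x with x in supp q, so that
     B_q'(d) log L_q = const * sum_x B_q'(x) / l_x^m = 0.
   After clearing denominators this is a bihomogeneous equation W(q, q') = 0,
   which therefore holds on the graph variety.  At (Z, Z') the pole along l_F gives
   B_Z'(F) = 0 in characteristic 0, a contradiction.
   That W = 0 holds on the whole graph of Psi_n follows from density of the orbit
   cycles of generic E, once an orbit cycle determines its Chow form.  The latter
   is the Nullstellensatz for an irreducible hypersurface, proved by Gauss's lemma
   on lines. *)

Require Import Defs.
From HB Require Import structures.
From mathcomp Require Import all_boot all_order all_algebra.
From mathcomp Require Import mpoly.
From mathcomp Require Import perm ring.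
From Stdlib Require Import Classical.

Set Implicit Arguments.
Unset Strict Implicit.
Unset Printing Implicit Defensive.

Import GRing.Theory.
Local Open Scope ring_scope.

(** * Polynomial functions and restriction to lines *)

(** The graph variety is known only through the bihomogeneous equations satisfied by the graph, so
    the inclusion of Q(supp q) in supp q' has to be expressed by a polynomial in both sets of Chow
    coordinates. Single points of supp q are not polynomial in q, but symmetric sums over them are,
    and derivatives of log L_q produce such sums: d_J d_j log l_x is a constant times x_j x_J /
    l_x^(m+1) when J has m entries, so B(d), with B of degree m, turns each x into B(x). The
    additional derivative d_j makes the expression rational; j is chosen with F_j nonzero. Distinct
    points have non-proportional l_x, so the pole along l_F cannot be cancelled by other points. Its
    coefficient is, up to a nonzero factor, the multiplicity of l_F times F_j B(F); the other
    factors of L_Z enter only through being nonzero at some point of l_F = 0. *)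

Lemma horner_all0 (k : closedFieldType) (p : {poly k}) :
  (forall t, p.[t] = 0) -> p = 0.
Proof.
move=> h; apply/eqP/negPn/negP => nz.
(* For p nonzero, 1 + p X is not constant and has a root, although it takes the value 1
   everywhere. *)
have /closed_rootP[t] : size (1 + p * 'X) != 1%N.
  rewrite addrC size_polyDl ?size_mulX // ?size_poly1 ?ltnS ?lt0n ?size_poly_eq0 //.
  by rewrite eqSS size_poly_eq0.
by rewrite rootE !hornerE h mul0r addr0 oner_eq0.
Qed.

Lemma muni_inj0 (R : nzRingType) n (p : {mpoly R[n.+1]}) : muni p = 0 -> p = 0.
Proof.
move=> p0; apply/mpolyP => m; rewrite mcoeff0.
pose m' := [multinom m (widen_ord (leqnSn n) i) | i < n].
have : ((muni p)`_(m ord_max))@_m' = 0 by rewrite p0 coef0 mcoeff0.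
rewrite muniE coef_sum raddf_sum /=.
have [mp|/memN_msupp_eq0 //] := boolP (m \in msupp p).
rewrite (bigD1_seq m) //= big1_seq ?addr0 => [|m2 /andP[m2m _]].
  by rewrite coefZ coefXn eqxx mulr1 mcoeffZ mcoeffX eqxx mulr1.
rewrite coefZ coefXn; case: eqP => [e|]; last by rewrite mulr0 mcoeff0.
rewrite mulr1 mcoeffZ mcoeffX; case: eqP => [e2|]; last by rewrite mulr0.
case/negP: m2m; apply/eqP/mnmP => i.
have [->|ne] := eqVneq i ord_max; first by rewrite e.
have lti : (i < n)%N.
  by rewrite ltn_neqAle -ltnS ltn_ord andbT; apply: contra ne => /eqP E; apply/eqP/val_inj.
have -> : i = widen_ord (leqnSn n) (Ordinal lti) by apply: val_inj.
by move/mnmP/(_ (Ordinal lti)): e2; rewrite !mnmE.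
Qed.

Lemma meval_muni (R : comNzRingType) n (p : {mpoly R[n.+1]}) (v : 'I_n -> R) t :
  (map_poly (meval v) (muni p)).[t] =
  p.@[fun i => if unlift ord_max i is Some j then v j else t].
Proof.
rewrite muniE [in RHS](mpolyE p) !raddf_sum /= horner_sum.
apply: eq_bigr => m _; rewrite mevalZ mevalX big_ord_recr /= unlift_none.
rewrite -mul_polyC rmorphM /= map_polyC map_polyXn /= hornerM hornerC hornerXn.
rewrite mevalZ mevalX -!mulrA; congr (_ * (_ * _)).
apply: eq_bigr => i _; rewrite mnmE.
have -> : widen_ord (leqnSn n) i = lift ord_max i.
  by apply: val_inj; rewrite /= /bump leqNgt ltn_ord.
by rewrite liftK.
Qed.

Lemma meval_all0 (k : closedFieldType) n (p : {mpoly k[n]}) :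
  (forall v, p.@[v] = 0) -> p = 0.
Proof.
elim: n p => [|n IH] p h.
  have := h (fun=> 0); rewrite (nvar0_mpolyC p) mevalC => ->.
  by rewrite mpolyC0.
apply: muni_inj0; apply/polyP => j; rewrite coef0; apply: IH => v.
suff e : map_poly (meval v) (muni p) = 0.
  by have /polyP/(_ j) := e; rewrite coef_map coef0.
by apply: horner_all0 => t; rewrite meval_muni.
Qed.

Section Peval.
Variable (k : fieldType) (n : nat).
Implicit Types (p q : {mpoly k[n]}) (x : 'rV[k]_n).

Lemma pevalM p q x : peval (p * q) x = peval p x * peval q x.
Proof. exact: mevalM. Qed.

Lemma pevalD p q x : peval (p + q) x = peval p x + peval q x.
Proof. exact: mevalD. Qed.

Lemma pevalB p q x : peval (p - q) x = peval p x - peval q x.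
Proof. exact: mevalB. Qed.

Lemma pevalZ c p x : peval (c *: p) x = c * peval p x.
Proof. exact: mevalZ. Qed.

Lemma pevalC c x : peval c%:MP x = c.
Proof. exact: mevalC. Qed.

Lemma peval0 x : peval 0 x = 0.
Proof. exact: meval0. Qed.

Lemma peval1 x : peval 1 x = 1.
Proof. exact: meval1. Qed.

Lemma pevalXU i x : peval 'X_i x = x ord0 i.
Proof. exact: mevalXU. Qed.

Lemma pevalXn p m x : peval (p ^+ m) x = peval p x ^+ m.
Proof. exact: rmorphXn. Qed.

Lemma peval_sum I (r : seq I) P (F : I -> {mpoly k[n]}) x :
  peval (\sum_(i <- r | P i) F i) x = \sum_(i <- r | P i) peval (F i) x.
Proof. exact: raddf_sum. Qed.

Lemma peval_prod I (r : seq I) P (F : I -> {mpoly k[n]}) x :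
  peval (\prod_(i <- r | P i) F i) x = \prod_(i <- r | P i) peval (F i) x.
Proof. exact: rmorph_prod. Qed.

Lemma peval_comp m (p' : {mpoly k[m]}) (lq : m.-tuple {mpoly k[n]}) x :
  peval (p' \mPo lq) x = peval p' (\row_i peval (tnth lq i) x).
Proof. by rewrite /peval comp_mpoly_meval; apply: meval_eq => i; rewrite mxE. Qed.

Lemma peval_homogZ e p c x : p \is e.-homog -> peval p (c *: x) = c ^+ e * peval p x.
Proof.
move=> /dhomogP hp; rewrite /peval !mevalE big_distrr /= !big_seq.
apply: eq_bigr => m /hp hm; rewrite mulrCA; congr (_ * _).
have -> : c ^+ e = \prod_i c ^+ m i by rewrite prodrXr -mdegE hm.
by rewrite -big_split; apply: eq_bigr => i _; rewrite mxE exprMn.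
Qed.

End Peval.

Lemma peval_all0 (k : closedFieldType) n (p : {mpoly k[n]}) :
  (forall x, peval p x = 0) -> p = 0.
Proof.
move=> h; apply: meval_all0 => v; rewrite -[RHS](h (\row_i v i)).
by apply: meval_eq => i; rewrite mxE.
Qed.

Lemma peval_neq0 (k : closedFieldType) n (p : {mpoly k[n]}) :
  p != 0 -> exists x, peval p x != 0.
Proof.
move=> nz; apply: NNPP => h; case/eqP: nz; apply: peval_all0 => x.
by apply/eqP/negPn/negP => hx; apply: h; exists x.
Qed.

Lemma peval_ext (k : closedFieldType) n (p q : {mpoly k[n]}) :
  (forall x, peval p x = peval q x) -> p = q.
Proof.
by move=> h; apply/eqP; rewrite -subr_eq0; apply/eqP/peval_all0 => x; rewrite pevalB h subrr.
Qed.

(* [tau w p] is p(X + t w), as a polynomial in t. *)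
Definition tau (k : fieldType) n (w : 'rV[k]_n) (p : {mpoly k[n]}) :
    {poly {mpoly k[n]}} :=
  mmap (polyC \o @mpolyC n k)
    (fun i => ('X_i)%:P + ((w ord0 i)%:MP)%:P * 'X) p.

Section Tau.
Variable (k : fieldType) (n : nat) (w : 'rV[k]_n).
Implicit Types (p q : {mpoly k[n]}) (x : 'rV[k]_n).

HB.instance Definition _ := GRing.RMorphism.copy (tau w)
  (mmap (polyC \o @mpolyC n k) (fun i => ('X_i)%:P + ((w ord0 i)%:MP)%:P * 'X)).

Definition line x p : {poly k} := map_poly (meval (x ord0)) (tau w p).

Lemma horner_line x p t : (line x p).[t] = peval p (x + t *: w).
Proof.
rewrite /line /tau /mmap /peval mevalE rmorph_sum /= horner_sum.
apply: eq_bigr => m _; rewrite rmorphM /= hornerM map_polyC hornerC /= mevalC.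
congr (_ * _); rewrite /mmap1 rmorph_prod horner_prod; apply: eq_bigr => i _.
rewrite rmorphXn /= horner_exp rmorphD rmorphM /= !map_polyC /= map_polyX.
by rewrite !hornerE mevalXU mevalC !mxE mulrC.
Qed.

Lemma tau_horner p (t : k) :
  (tau w p).[t%:MP] = p \mPo [tuple 'X_i + (t * w ord0 i)%:MP | i < n].
Proof.
rewrite /tau /mmap comp_mpolyE horner_sum.
apply: eq_bigr => m _; rewrite hornerM hornerC /= mul_mpolyC.
congr (_ *: _); rewrite /mmap1 horner_prod; apply: eq_bigr => i _.
by rewrite horner_exp !hornerE tnth_mktuple -mpolyCM mulrC.
Qed.

Lemma tau_horner0 p : (tau w p).[0] = p.
Proof.
rewrite -[0]mpolyC0 tau_horner -[RHS]comp_mpoly_id; congr comp_mpoly.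
by apply: eq_mktuple => i; rewrite mul0r mpolyC0 addr0.
Qed.

End Tau.

(** * Irreducible hypersurfaces *)

Section TopCoefficient.
Variable R : comNzRingType.
Implicit Types (P Q : {poly R}).

(** The coefficient c may be 0, so the notion is stable under products over any commutative ring. *)
Definition has_top (d : nat) (c : R) P := (size P <= d.+1)%N /\ P`_d = c.

Lemma has_top_mul d e a b P Q :
  has_top d a P -> has_top e b Q -> has_top (d + e) (a * b) (P * Q).
Proof.
move=> [sP <-] [sQ <-]; split.
  apply: leq_trans (size_polyMleq _ _) _.
  by rewrite -subn1 leq_subLR add1n -addnS -addSn leq_add.
rewrite coefM (bigD1 (inord d)) //= inordK ?ltnS ?leq_addr // addKn big1 ?addr0 //.
move=> i ne; have [lt|le] := ltnP i d.
  rewrite [Q`__]nth_default ?mulr0 //; apply: leq_trans sQ _.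
  by rewrite ltn_subRL ltn_add2r.
rewrite nth_default ?mul0r //; apply: leq_trans sP _.
rewrite ltn_neqAle le andbT; apply: contra ne => /eqP E.
by apply/eqP/val_inj; rewrite /= inordK ?ltnS ?leq_addr.
Qed.

Lemma has_top1 : has_top 0 1 1.
Proof. by split; rewrite ?size_poly1 // coef1. Qed.

Lemma has_top_exp d a P m : has_top d a P -> has_top (d * m) (a ^+ m) (P ^+ m).
Proof.
move=> h; elim: m => [|m IH]; first by rewrite muln0; apply: has_top1.
by rewrite mulnS !exprS; apply: has_top_mul.
Qed.

Lemma has_top_prod I (r : seq I) (d : I -> nat) (a : I -> R) (P : I -> {poly R}) :
  (forall i, has_top (d i) (a i) (P i)) ->
  has_top (\sum_(i <- r) d i) (\prod_(i <- r) a i) (\prod_(i <- r) P i).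
Proof.
move=> h; elim: r => [|i r IH]; first by rewrite !big_nil; apply: has_top1.
by rewrite !big_cons; apply: has_top_mul.
Qed.

End TopCoefficient.

Definition top_form (k : fieldType) n (p : {mpoly k[n]}) : {mpoly k[n]} :=
  pihomog mdeg (msize p).-1 p.

Lemma top_form_neq0 (k : fieldType) n (p : {mpoly k[n]}) : p != 0 -> top_form p != 0.
Proof.
move=> nz; apply/eqP => /mpolyP/(_ (mlead p)) /eqP.
rewrite mcoeff0 /top_form pihomogE raddf_sum big_mkcond /=.
rewrite (bigD1_seq (mlead p)) ?mlead_supp ?msupp_uniq //= -mlead_deg // eqxx.
rewrite mcoeffZ mcoeffX eqxx mulr1 big1_seq ?addr0 ?mleadc_eq0 ?(negPf nz) //.
by move=> m /andP[ne _]; case: ifP => // _; rewrite mcoeffZ mcoeffX (negPf ne) mulr0.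
Qed.

(** The coefficient of t^(deg p) in p(X + t w) does not involve X. Hence a direction w off the zeros
    of the top form makes p keep its degree on all lines parallel to w, and makes p(X + t w) have a
    unit as leading coefficient. *)
Lemma tau_top (k : fieldType) n (w : 'rV[k]_n) (p : {mpoly k[n]}) : p != 0 ->
  has_top (msize p).-1 (peval (top_form p) w)%:MP (tau w p).
Proof.
move=> nz.
have hm m : has_top (mdeg m) (peval 'X_[m] w)%:MP
    (mmap1 (fun i => ('X_i)%:P + ((w ord0 i)%:MP)%:P * 'X) m : {poly {mpoly k[n]}}).
  rewrite /peval mevalX rmorph_prod mdegE /mmap1; apply: has_top_prod => i /=.
  rewrite rmorphXn /= -[m i in X in has_top X]mul1n; apply: has_top_exp; split.
    apply: leq_trans (size_polyD _ _) _; rewrite geq_max.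
    rewrite (leq_trans (size_polyC_leq1 _)) //= (leq_trans (size_polyMleq _ _)) //.
    by rewrite size_polyX addn2 /= ltnS size_polyC_leq1.
  by rewrite coefD !coefC /= coefMX coefC eqxx add0r.
rewrite /tau /mmap; split.
  rewrite (leq_trans (size_sum _ _ _)) //.
  apply/bigmax_leqP_seq => m mp _; rewrite mul_polyC.
  rewrite (leq_trans (size_scale_leq _ _)) // (leq_trans (proj1 (hm m))) //.
  by rewrite -mpolySpred // msize_mdeg_lt.
rewrite coef_sum /top_form pihomogE peval_sum raddf_sum /= [RHS]big_mkcond /=.
rewrite !big_seq; apply: eq_bigr => m mp; rewrite mul_polyC coefZ.
case: eqP => [e|ne]; first by rewrite -e (proj2 (hm m)) pevalZ mpolyCM.
rewrite nth_default ?mulr0 //; apply: leq_trans (proj1 (hm m)) _.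
rewrite ltn_neqAle; move/eqP: ne => -> /=.
by rewrite -ltnS -mpolySpred // msize_mdeg_lt.
Qed.

Section TauTop.
Variables (k : fieldType) (n : nat) (w : 'rV[k]_n) (p : {mpoly k[n]}).
Hypothesis pw : peval (top_form p) w != 0.

Let nz : p != 0.
Proof. by apply: contra pw => /eqP ->; rewrite /top_form raddf0 peval0. Qed.

Lemma size_tau : size (tau w p) = msize p.
Proof.
have [le e] := tau_top w nz; apply/eqP; rewrite eqn_leq (mpolySpred _ nz) le /=.
by apply: contraNT pw; rewrite -leqNgt -(mpolyC_eq0 n) -e => h; rewrite nth_default.
Qed.

Lemma lead_tau : lead_coef (tau w p) = (peval (top_form p) w)%:MP.
Proof. by rewrite lead_coefE size_tau (proj2 (tau_top w nz)). Qed.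

Lemma lead_tau_unit : lead_coef (tau w p) \in GRing.unit.
Proof. by rewrite lead_tau rmorph_unit // unitfE. Qed.

Lemma size_line y : size (line w y p) = msize p.
Proof. by rewrite size_map_poly_id0 ?size_tau // lead_tau mevalC. Qed.

Lemma line_neq0 y : line w y p != 0.
Proof. by rewrite -size_poly_eq0 size_line msize_poly_eq0. Qed.

End TauTop.

Section LineMorph.
Variables (k : fieldType) (n : nat) (w y : 'rV[k]_n).
HB.instance Definition _ := GRing.RMorphism.copy (line w y)
  (map_poly (meval (y ord0)) \o tau w).
End LineMorph.

Lemma map_meval_all0 (k : closedFieldType) n (P : {poly {mpoly k[n]}}) :
  (forall y : 'rV_n, map_poly (meval (y ord0)) P = 0) -> P = 0.
Proof.
move=> h; apply/polyP => i; rewrite coef0; apply: peval_all0 => y.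
by rewrite /peval -coef_map h coef0.
Qed.

(* Divisibility of multivariate polynomials can be tested on parallel lines,
   as long as the divisor keeps its degree on them. *)
Lemma dvd_lines (k : closedFieldType) n (w : 'rV[k]_n) (b g : {mpoly k[n]}) :
  peval (top_form b) w != 0 ->
  (forall y, line w y b %| line w y g) -> exists q, g = q * b.
Proof.
move=> bw h; pose B := tau w b; pose G := tau w g.
have uB : lead_coef B \in GRing.unit by apply: lead_tau_unit.
(* Division in t over the polynomial ring is possible because the leading coefficient is a unit. On
   each line the remainder is a multiple of the divisor of smaller degree, hence 0. *)
have e := Pdiv.IdomainUnit.divp_eq uB G.
have nzB : B != 0.
  by rewrite -lead_coef_eq0; apply: contraTneq uB => ->; rewrite unitr0.
have r0 : G %% B = 0.
  apply: map_meval_all0 => y; set r := map_poly _ _.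
  have E : line w y g = map_poly (meval (y ord0)) (G %/ B) * line w y b + r.
    by rewrite /line -/G {1}e rmorphD rmorphM.
  have hr : (size r <= size (G %% B)%R)%N by apply: size_poly.
  have hb : size (line w y b) = size B by rewrite size_line // -(size_tau bw).
  have := h y; rewrite E; move: (line w y b) (map_poly _ _) hb => lb q hb.
  rewrite dvdp_addr; last by apply: dvdp_mull.
  move=> /dvdp_leq le; apply/eqP/negPn/negP => nz.
  have := le nz; rewrite leqNgt => /negP; apply.
  by rewrite hb; apply: leq_ltn_trans hr _; rewrite ltn_modp.
have hG : G.[0] = g := tau_horner0 w g; have hB : B.[0] = b := tau_horner0 w b.
(* At t = 0 the polynomials p(X + t w) become p again. *)
rewrite r0 addr0 in e; exists ((G %/ B).[0]).
by rewrite -hG -hB -hornerM -e.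
Qed.

(* Gauss's lemma over k[s]: at a root of [b * c] one of G, H vanishes, so the
   roots can be cancelled one by one. *)
Lemma gauss_line (k : closedFieldType) (b c : {poly k}) (G H P : {poly {poly k}}) i0 j0 :
  b != 0 -> c != 0 -> G`_i0 = b -> H`_j0 = c -> (b * c)%:P * P = G * H ->
  (forall i, b %| G`_i) /\ (forall j, c %| H`_j).
Proof.
have [N leN] := ubnP (size b + size c).
elim: N b c G H i0 j0 leN => // N IH b c G H i0 j0 leN b0 c0 Gb Hc E.
have [/eqP s1|/closed_rootP[s rs]] := boolP (size (b * c) == 1%N).
  have : (size b == 1%N) && (size c == 1%N).
    have := s1; rewrite size_mul //.
    move: b0 c0; rewrite -!size_poly_gt0; case: (size b) (size c) => // x [] // y _ _.
    by rewrite addSn addnS /= => -[] /eqP; rewrite addn_eq0 => /andP[/eqP-> /eqP->].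
  by rewrite !size_poly_eq1 => /andP[hb hc]; split=> i; rewrite ?(eqp_dvdl _ hb) ?(eqp_dvdl _ hc) dvd1p.
(* The case where G vanishes at the root s: X - s divides all coefficients of G, in particular b,
   and is cancelled. Stated for fresh variables, to be used also with the roles of G and H
   exchanged. *)
have step (b' c' : {poly k}) (G' H' : {poly {poly k}}) i1 j1 :
    (size b' + size c' < N.+1)%N -> b' != 0 -> c' != 0 -> G'`_i1 = b' ->
    H'`_j1 = c' -> (b' * c')%:P * P = G' * H' -> map_poly (horner^~ s) G' = 0 ->
    (forall i, b' %| G'`_i) /\ (forall j, c' %| H'`_j).
  move=> lt nb nc Gb' Hc' E' G0.
  have dv i : ('X - s%:P) %| G'`_i.
    by rewrite dvdp_XsubCl rootE -[X in X == _](coef_map_id0 (f := horner^~ s)) ?G0 ?coef0 ?horner0.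
  pose G1 : {poly {poly k}} := \poly_(i < size G') (G'`_i %/ ('X - s%:P)).
  have G1E : G' = ('X - s%:P)%:P * G1.
    apply/polyP => i; rewrite coefCM coef_poly; case: ltnP => [_|le].
      by rewrite mulrC divpK.
    by rewrite nth_default ?mulr0.
  have nX : 'X - s%:P != 0 :> {poly k} by rewrite polyXsubC_eq0.
  have bE : b' = ('X - s%:P) * G1`_i1 by rewrite -Gb' G1E coefCM.
  have nG1 : G1`_i1 != 0 by move: nb; rewrite bE mulf_eq0 negb_or => /andP[].
  have lt1 : (size (G1`_i1)%R + size c' < N)%N.
    by move: lt; rewrite ltnS bE size_mul // size_XsubC add2n /= addSn.
  have E1 : (G1`_i1 * c')%:P * P = G1 * H'.
    have nXP : ('X - s%:P)%:P != 0 :> {poly {poly k}} by rewrite polyC_eq0.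
    by apply: (mulfI nXP); rewrite !mulrA -G1E -E' bE -rmorphM /= mulrA.
  have [h1 h2] := IH _ _ _ _ i1 j1 lt1 nG1 nc (erefl _) Hc' E1.
  split=> // i; rewrite bE G1E coefCM dvdp_mul2l //.
have e0 : map_poly (horner^~ s) G * map_poly (horner^~ s) H = 0.
  have -> : horner^~ s = horner_eval s by [].
  rewrite -rmorphM -E rmorphM /= map_polyC /= /horner_eval.
  by move/rootP: rs => ->; rewrite polyC0 mul0r.
move/eqP: e0; rewrite mulf_eq0 => /orP[/eqP|/eqP] h0; first exact: (step _ _ _ _ i0 j0).
have [||h1 h2] := step c b H G j0 i0 _ c0 b0 Hc Gb _ h0; first by rewrite addnC.
  by rewrite mulrC (mulrC b) in E *; rewrite mulrC E mulrC.
by split.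
Qed.

(** Restriction to a line is a ring morphism to k[s], which brings [gauss_line] to bear on every
    line in a direction where both b and c keep their degrees; [dvd_lines] then lifts the
    divisibility of each coefficient. *)
Lemma gauss_mpoly (k : closedFieldType) n (b c : {mpoly k[n]})
    (G H P : {poly {mpoly k[n]}}) i0 j0 :
  b != 0 -> c != 0 -> G`_i0 = b -> H`_j0 = c -> (b * c)%:P * P = G * H ->
  exists G', G = b%:P * G'.
Proof.
move=> b0 c0 Gb Hc E.
have [w] : exists w, peval (top_form b * top_form c) w != 0.
  by apply: peval_neq0; rewrite mulf_neq0 ?top_form_neq0.
rewrite pevalM mulf_eq0 negb_or => /andP[bw cw].
have dv i : exists q, G`_i == q * b.
  have [y|q ->] := @dvd_lines _ _ w b G`_i bw; last by exists q.
  have [phi hphi] : exists phi : {rmorphism {mpoly k[n]} -> {poly k}}, line w y =1 phi.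
    by exists (line w y).
  have nb := line_neq0 bw y; have nc := line_neq0 cw y.
  rewrite !hphi in nb nc *.
  have e1 : (map_poly phi G)`_i0 = phi b by rewrite coef_map Gb.
  have e2 : (map_poly phi H)`_j0 = phi c by rewrite coef_map Hc.
  have e3 : (phi b * phi c)%:P * map_poly phi P = map_poly phi G * map_poly phi H.
    by rewrite -rmorphM -(map_polyC phi) -!rmorphM E.
  by have [/(_ i) h _] := gauss_line nb nc e1 e2 e3; rewrite coef_map in h.
exists (\poly_(i < size G) xchoose (dv i)); apply/polyP => i.
rewrite coefCM coef_poly; case: ltnP => [_|le].
  by rewrite mulrC; apply/eqP/(xchooseP (dv i)).
by rewrite nth_default ?mulr0.
Qed.

Lemma unit_peval (k : fieldType) n (p : {mpoly k[n]}) x :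
  p \is a GRing.unit -> peval p x != 0.
Proof. by move=> u; rewrite -unitfE; exact: (rmorph_unit (meval (x ord0))). Qed.

Lemma mpoly_unitE (k : fieldType) n (p : {mpoly k[n]}) :
  (p \is a GRing.unit) = (msize p == 1).
Proof.
apply/idP/idP => [/andP[/eqP e u]|/msize_poly1P[c c0 ->]].
  by rewrite e msizeC -unitfE u.
by rewrite rmorph_unit // unitfE.
Qed.

Definition shift (k : fieldType) n (v : 'rV[k]_n) (p : {mpoly k[n]}) : {mpoly k[n]} :=
  p \mPo [tuple 'X_i + (v ord0 i)%:MP | i < n].

HB.instance Definition _ (k : fieldType) n (v : 'rV[k]_n) :=
  GRing.RMorphism.copy (shift v) (comp_mpoly [tuple 'X_i + (v ord0 i)%:MP | i < n]).

Lemma peval_shift (k : fieldType) n (v x : 'rV[k]_n) p :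
  peval (shift v p) x = peval p (x + v).
Proof.
rewrite peval_comp; congr peval; apply/rowP => i; rewrite !mxE tnth_mktuple.
by rewrite pevalD pevalXU pevalC.
Qed.

Lemma shiftK (k : closedFieldType) n (v : 'rV[k]_n) : cancel (shift v) (shift (- v)).
Proof. by move=> p; apply: peval_ext => x; rewrite !peval_shift subrK. Qed.

Lemma tau_shift (k : fieldType) n (w : 'rV[k]_n) (t : k) p :
  (tau w p).[t%:MP] = shift (t *: w) p.
Proof.
rewrite tau_horner; congr comp_mpoly; apply: eq_mktuple => i.
by rewrite mxE.
Qed.

(* The case of a hypersurface of Hilbert's Nullstellensatz. *)
Lemma irreducible_dvd (k : closedFieldType) n (P Q : {mpoly k[n]}) :
  irreducible_mpoly P -> (forall x, peval P x = 0 -> peval Q x = 0) ->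
  exists S, Q = S * P.
Proof.
move=> [P0 Pu Pirr] PQ.
have [->|Q0] := eqVneq Q 0; first by exists 0; rewrite mul0r.
have [w pw] := peval_neq0 (top_form_neq0 P0).
have [A eA] : {A | A = tau w P} := exist _ _ erefl.
have [B eB] : {B | B = tau w Q} := exist _ _ erefl.
have lA := lead_tau pw; rewrite -eA in lA.
move: (peval (top_form P) w) (pw) lA => a a0 lA.
have B0 : B != 0.
  by apply: contraNneq Q0 => h; rewrite -(tau_horner0 w Q) -eB h horner0.
have A0 : A != 0 by rewrite -lead_coef_eq0 lA mpolyC_eq0.
(* If A and B are coprime in t, some combination of them is a nonzero r free of t. On the line
   through a point y with r(y) nonzero, P keeps its degree and so has a zero; Q vanishes there too,
   which forces r(y) = 0. *)
have [cop|ncop] := boolP (coprimep A B).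
  have /Pdiv.Idomain.Bezout_coprimepP[[u v] /=] := cop.
  rewrite -size_poly_eq1 => /size_poly1P[r r0 E].
  have [y ry] := peval_neq0 r0.
  have /closed_rootP[t] : size (line w y P) != 1.
    by rewrite size_line // -mpoly_unitE.
  rewrite rootE horner_line => /eqP Pt.
  have hA : (map_poly (meval (y ord0)) A).[t] = 0.
    by rewrite eA -/(line w y P) horner_line.
  have hB : (map_poly (meval (y ord0)) B).[t] = 0.
    by rewrite eB -/(line w y Q) horner_line PQ.
  have := congr1 (fun p => (map_poly (meval (y ord0)) p).[t]) E.
  rewrite rmorphD !rmorphM /= hornerD !hornerM hA hB !mulr0 addr0.
  by rewrite map_polyC hornerC /= => /esym/eqP; rewrite (negPf ry).
have [G [H [K [c [d [c0 d0 sG [EA EB]]]]]]] :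
    exists (G H K : {poly {mpoly k[n]}}) (c d : {mpoly k[n]}),
    [/\ c != 0, d != 0, (1 < size G)%N & c *: A = H * G /\ d *: B = K * G].
  have /Pdiv.Idomain.dvdpP[[c H] /= c0 EA] := dvdp_gcdl A B.
  have /Pdiv.Idomain.dvdpP[[d K] /= d0 EB] := dvdp_gcdr A B.
  exists (gcdp A B), H, K, c, d; split=> //.
  by rewrite ltn_neqAle eq_sym size_poly_gt0 gcdp_eq0 negb_and A0 andbT.
have G0 : G != 0 by rewrite -size_poly_gt0 ltnW.
have H0 : H != 0.
  by apply: contraNneq A0 => h; move/eqP: EA; rewrite h mul0r -mul_polyC mulf_eq0 polyC_eq0 (negPf c0).
have lG : lead_coef G != 0 by rewrite lead_coef_eq0.
have lH : lead_coef H != 0 by rewrite lead_coef_eq0.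
(* Comparing leading coefficients, c a is the product of those of G and H. Trading c for this
   product gives the shape required by [gauss_mpoly], which then divides G and H by their leading
   coefficients; G1 becomes monic. *)
have gau : (lead_coef G * lead_coef H)%:P * ((a^-1)%:MP *: A) = G * H.
  rewrite (mulrC G) -EA (mulrC (lead_coef G)) -lead_coefM -EA lead_coefZ lA.
  by rewrite mul_polyC scalerA -mulrA -mpolyCM mulfV // mulr1.
have gau' : (lead_coef H * lead_coef G)%:P * ((a^-1)%:MP *: A) = H * G.
  by rewrite (mulrC H) -gau (mulrC (lead_coef H)).
have [G1 eG] := gauss_mpoly lG lH erefl erefl gau.
have [H1 eH] := gauss_mpoly lH lG erefl erefl gau'.
have EA1 : A = (a%:MP)%:P * (G1 * H1).
  have /mulfI : (lead_coef G * lead_coef H)%:P != 0 by rewrite polyC_eq0 mulf_neq0.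
  apply; rewrite mulrCA rmorphM /=.
  have -> : (lead_coef G)%:P * (lead_coef H)%:P * (G1 * H1) =
    ((lead_coef G)%:P * G1) * ((lead_coef H)%:P * H1) by rewrite mulrACA.
  rewrite -eG -eH -gau [RHS]mulrCA (mul_polyC a%:MP) scalerA -mpolyCM mulfV //.
  by rewrite scale1r rmorphM.
have mG1 : G1 \is monic.
  have := congr1 (fun p => lead_coef p) eG; rewrite lead_coefM lead_coefC.
  by rewrite -[LHS]mulr1 => /(mulfI lG)/esym/eqP.
have [M eM] : exists M, B = M * G1.
  have : G1 %| B.
    apply/Pdiv.Idomain.dvdpP; exists (d, (lead_coef G)%:P * K) => //=.
    by rewrite EB mulrAC -eG mulrC.
  by case/(Pdiv.IdomainMonic.dvdpP mG1) => M ->; exists M.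
have sG1 : size (map_poly (meval ((0 : 'rV[k]_n) ord0)) G1) != 1.
  rewrite size_map_poly_id0; last by rewrite (monicP mG1) meval1 oner_neq0.
  have : size G = size G1 by rewrite eG mul_polyC size_scale.
  by move <-; rewrite neq_ltn sG orbT.
(* Setting t = s and translating back by s w undoes [tau]. The choice of s makes the image of G1
   vanish at the point s w, so this factor of P is not a unit and its cofactor is one. *)
have /closed_rootP[s rs] := sG1.
pose phi (p : {poly {mpoly k[n]}}) := shift (- (s *: w)) p.[s%:MP].
have phiM p q : phi (p * q) = phi p * phi q by rewrite /phi hornerM rmorphM.
have phiP : phi A = P by rewrite /phi eA tau_shift shiftK.
have phiQ : phi B = Q by rewrite /phi eB tau_shift shiftK.
have PE : P = phi G1 * (a%:MP * phi H1).
  rewrite -phiP EA1 !phiM mulrCA; congr (_ * (_ * _)).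
  by rewrite /phi hornerC; apply: comp_mpolyC.
have [u|u] := Pirr _ _ PE.
  have := unit_peval (s *: w) u; rewrite peval_shift addrN /peval.
  move/rootP: rs; rewrite -[s in _.[s]](mevalC ((0 : 'rV[k]_n) ord0)) horner_map.
  by move=> ->; rewrite eqxx.
exists (phi M * (a%:MP * phi H1)^-1).
by rewrite -phiQ eM phiM PE (mulrC (phi G1)) -mulrA mulKr.
Qed.

Lemma irreducible_same_zeros (k : closedFieldType) n (P Q : {mpoly k[n]}) :
  irreducible_mpoly P -> irreducible_mpoly Q ->
  (forall x, peval P x = 0 <-> peval Q x = 0) ->
  exists2 c, c != 0 & Q = c *: P.
Proof.
move=> iP iQ PQ.
have [S QE] : exists S, Q = S * P by apply: irreducible_dvd => // x /PQ.
case: (iP) (iQ) => [P0 Pu _] [Q0 _ /(_ _ _ QE)[|]]; last by rewrite (negPf Pu).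
rewrite mpoly_unitE => /msize_poly1P[c c0 Sc].
by exists c; rewrite // QE Sc mul_mpolyC.
Qed.

(** * Products of linear forms *)

(** The form l_x on the dual space: its zeros are the hyperplanes through x. *)
Definition lform (k : fieldType) n (x : 'rV[k]_n) : {mpoly k[n]} :=
  \sum_i x ord0 i *: 'X_i.

Section LinearForm.
Variables (k : fieldType) (n : nat).
Implicit Types (x y u b : 'rV[k]_n).

Lemma peval_lform x u : peval (lform x) u = \sum_i x ord0 i * u ord0 i.
Proof. by rewrite peval_sum; apply: eq_bigr => i _; rewrite pevalZ pevalXU. Qed.

Lemma lform_sym x u : peval (lform x) u = peval (lform u) x.
Proof. by rewrite !peval_lform; apply: eq_bigr => i _; rewrite mulrC. Qed.

Lemma lformD x u v : peval (lform x) (u + v) = peval (lform x) u + peval (lform x) v.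
Proof. by rewrite !peval_lform -big_split; apply: eq_bigr => i _; rewrite mxE mulrDr. Qed.

Lemma lformZ x c u : peval (lform x) (c *: u) = c * peval (lform x) u.
Proof. by rewrite !peval_lform big_distrr; apply: eq_bigr => i _; rewrite mxE mulrCA. Qed.

Lemma mderiv_lform x i : (lform x)^`M(i) = (x ord0 i)%:MP.
Proof.
rewrite /lform raddf_sum (bigD1 i) //= big1 ?addr0 => [|j ne].
  have UU : (U_(i) - U_(i) = 0 :> 'X_{1..n})%MM.
    by apply/mnmP => j; rewrite mnmBE mnm0E subnn.
  by rewrite mderivZ mderivX mnm1E eqxx scale1r UU mpolyX0 alg_mpolyC.
by rewrite mderivZ mderivX mnm1E (negPf ne) scale0r scaler0.
Qed.

Lemma mcoeff_lform x i : (lform x)@_U_(i) = x ord0 i.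
Proof.
rewrite /lform raddf_sum (bigD1 i) //= big1 ?addr0 => [|j ne].
  by rewrite mcoeffZ mcoeffXU eqxx mulr1.
by rewrite mcoeffZ mcoeffXU (negPf ne) mulr0.
Qed.

Lemma lform_eq0 x : (lform x == 0) = (x == 0).
Proof.
apply/eqP/eqP => [h|->]; last by apply: big1 => i _; rewrite mxE scale0r.
by apply/rowP => i; rewrite -mcoeff_lform h mcoeff0 mxE.
Qed.

Lemma dhomog_lform x : lform x \is 1.-homog.
Proof. by apply: rpred_sum => i _; apply: rpredZ; rewrite dhomogX /= mdeg1. Qed.

Lemma msize_lform x : x != 0 -> msize (lform x) = 2.
Proof.
move=> nz; have l0 : lform x != 0 by rewrite lform_eq0.
by rewrite -mlead_deg // (dhomog_mf (dhomog_lform x)) ?mlead_supp.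
Qed.

Lemma lform_irreducible x : x != 0 -> irreducible_mpoly (lform x).
Proof.
move=> nz; have l0 : lform x != 0 by rewrite lform_eq0.
split=> //; first by rewrite mpoly_unitE msize_lform.
move=> A B E; rewrite !mpoly_unitE.
have : A * B != 0 by rewrite -E.
rewrite mulf_eq0 negb_or => /andP[A0 B0].
have := msize_lform nz; rewrite E msizeM //.
move: A0 B0; rewrite -!msize_poly_eq0.
case: (msize A) (msize B) => [|[|i]] [|[|j]] //; rewrite ?addnS ?addSn //=; auto.
Qed.

End LinearForm.

Lemma lform_dvd (k : closedFieldType) n (x : 'rV[k]_n) L : x != 0 ->
  (forall u, peval (lform x) u = 0 -> peval L u = 0) -> exists M, L = M * lform x.
Proof. by move=> x0; apply/irreducible_dvd/lform_irreducible. Qed.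

(* Composition with the projection along b onto the hyperplane orthogonal to x. *)
Definition projp (k : fieldType) n (x b : 'rV[k]_n) (p : {mpoly k[n]}) :=
  p \mPo [tuple 'X_i - (b ord0 i / peval (lform x) b) *: lform x | i < n].

HB.instance Definition _ (k : fieldType) n (x b : 'rV[k]_n) :=
  GRing.RMorphism.copy (projp x b)
    (comp_mpoly [tuple 'X_i - (b ord0 i / peval (lform x) b) *: lform x | i < n]).

Lemma peval_projp (k : fieldType) n (x b u : 'rV[k]_n) p :
  peval (projp x b p) u =
  peval p (u - (peval (lform x) u / peval (lform x) b) *: b).
Proof.
rewrite peval_comp; congr peval; apply/rowP => i; rewrite !mxE tnth_mktuple.
by rewrite pevalB pevalXU pevalZ; congr (_ - _); rewrite mulrC mulrA mulrAC.
Qed.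

Lemma projp_dvd (k : closedFieldType) n (x b : 'rV[k]_n) p :
  x != 0 -> projp x b p = 0 -> exists M, p = M * lform x.
Proof.
move=> x0 h; apply: lform_dvd => // u xu.
by have := peval0 u; rewrite -h peval_projp xu mul0r scale0r subr0.
Qed.

(** Composition with a projection onto l_x = 0 is a ring morphism into a domain, and whatever it
    kills is a multiple of l_x. *)
Lemma lform_prime (k : closedFieldType) n (x : 'rV[k]_n) p q : x != 0 ->
  (forall u, peval (lform x) u = 0 -> peval (p * q) u = 0) ->
  (exists M, p = M * lform x) \/ (exists M, q = M * lform x).
Proof.
move=> x0 h; have [b xb] : exists b, peval (lform x) b != 0.
  by apply: peval_neq0; rewrite lform_eq0.
have : projp x b (p * q) = 0.
  apply: peval_all0 => u; rewrite peval_projp h // -scaleNr lformD lformZ.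
  by rewrite mulNr divfK // subrr.
rewrite rmorphM => /eqP; rewrite mulf_eq0 => /orP[]/eqP.
  by move/(projp_dvd x0); left.
by move/(projp_dvd x0); right.
Qed.

Lemma factor_max (k : closedFieldType) n (X : 'rV[k]_n -> Prop) (L : {mpoly k[n]}) :
  L != 0 -> (forall x, X x -> x != 0) ->
  exists s N, [/\ forall x, x \in s -> X x, L = N * \prod_(x <- s) lform x &
                  forall x, X x -> ~ exists M, N = M * lform x].
Proof.
move=> L0 X0.
suff : forall m N s, (msize N < m)%N -> (forall x, x \in s -> X x) ->
    L = N * \prod_(x <- s) lform x -> 
    exists s N, [/\ forall x, x \in s -> X x, L = N * \prod_(x <- s) lform x &
                  forall x, X x -> ~ exists M, N = M * lform x].
  move=> h; apply: (h (msize L).+1 L [::]) => //.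
  by rewrite big_nil mulr1.
elim=> // m IH N s lt sX E.
case: (classic (exists x, X x /\ exists M, N = M * lform x)) => [[x [Xx [M NE]]]|no].
  apply: (IH M (x :: s)).
  - have : N != 0 by apply: contraNneq L0 => N0; rewrite E N0 mul0r.
    rewrite NE mulf_eq0 negb_or => /andP[M0 l0].
    by move: lt; rewrite NE msizeM // msize_lform ?X0 // addn2.
  - by move=> y; rewrite inE => /orP[/eqP->|/sX].
  - by rewrite big_cons mulrA -NE.
by exists s, N; split=> // x Xx h; apply: no; exists x.
Qed.

(* On a generic line the zeros of N are among the finitely many points where
   the linear forms vanish, so N is constant. *)
Lemma factor_lforms (k : closedFieldType) n (X : 'rV[k]_n -> Prop) (L : {mpoly k[n]}) :
  L != 0 -> (forall x, X x -> x != 0) ->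
  (forall u, peval L u = 0 <-> exists2 x, X x & peval (lform x) u = 0) ->
  exists s c, (forall x, x \in s -> X x) /\ L = c *: \prod_(x <- s) lform x.
Proof.
move=> L0 X0 LX; have [s [N [sX LE ndv]]] := factor_max L0 X0.
have N0 : N != 0 by apply: contraNneq L0 => N0; rewrite LE N0 mul0r.
(* A zero of N is a zero of L, hence of some l_x with x in X. By maximality l_x does not divide N,
   so it divides the product already split off. This replaces X by the finite list s. *)
have zN u : peval N u = 0 -> exists2 y, y \in s & peval (lform y) u = 0.
  move=> Nu; have /LX[x Xx xu] : peval L u = 0 by rewrite LE pevalM Nu mul0r.
  have [v xv||[M PE]] := @lform_prime _ _ x N (\prod_(x <- s) lform x) (X0 _ Xx).
  - by rewrite -LE; apply/LX; exists x.
  - by move/(ndv _ Xx).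
  have : peval (\prod_(x <- s) lform x) u = 0 by rewrite PE pevalM xu mulr0.
  by rewrite peval_prod => /eqP; rewrite prodf_seq_eq0 => /hasP[y ys /eqP h]; exists y.
have [/eqP N1|nconst] := eqVneq N (peval N 0)%:MP.
  by exists s, (peval N 0); split; rewrite // LE {1}(eqP N1) mul_mpolyC.
have P0 : \prod_(x <- s) lform x != 0.
  by apply: contraNneq L0 => h; rewrite LE h mulr0.
have [b] : exists b, peval ((N - (peval N 0)%:MP) * \prod_(x <- s) lform x) b != 0.
  by apply: peval_neq0; rewrite mulf_neq0 // subr_eq0.
rewrite pevalM pevalB pevalC mulf_eq0 negb_or => /andP[Nb Pb].
have sb y : y \in s -> peval (lform y) b != 0.
  by move=> ys; apply: contraNneq Pb => h; rewrite peval_prod (big_rem y) //= h mul0r.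
(* On the line through a in direction b, either N is constant and the first factor is 0 at a, or N
   has a zero; some l_y vanishes there, so that zero is the projection of a along b, and the second
   factor is 0 at a. The first factor is not identically 0 since N(b) differs from N(0). *)
have : (shift b N - N) * \prod_(y <- s) projp y b N = 0.
  apply: peval_all0 => a; rewrite pevalM pevalB peval_shift peval_prod.
  have [/size_poly1P[c _ cE]|/closed_rootP[t]] := boolP (size (line b a N) == 1).
    have h t : peval N (a + t *: b) = c by rewrite -horner_line cE hornerC.
    by have := h 0; rewrite scale0r addr0 => ->; have := h 1; rewrite scale1r => ->; rewrite subrr mul0r.
  rewrite rootE horner_line => /eqP Nt; have [y ys] := zN _ Nt.
  rewrite lformD lformZ => /eqP; rewrite addr_eq0 => /eqP e.
  rewrite (big_rem y) //= peval_projp e mulNr mulfK ?sb // scaleNr opprK Nt.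
  by rewrite mul0r mulr0.
move/eqP; rewrite mulf_eq0 => /orP[/eqP h|].
  have := peval0 (0 : 'rV[k]_n); rewrite -h pevalB peval_shift add0r => /eqP.
  by rewrite (negPf Nb).
rewrite prodf_seq_eq0 => /hasP[y ys /eqP h].
by case: (ndv y (sX _ ys)); apply: projp_dvd h; apply: X0; apply: sX.
Qed.

(** * Logarithmic derivatives *)

(* [dlog j J L] is L^m d_J d_j (log L), where m = 1 + size J. *)
Fixpoint dlog (k : fieldType) n (j : 'I_n) (J : seq 'I_n) (L : {mpoly k[n]}) :=
  if J is c :: J' then
    L * (dlog j J' L)^`M(c) - (size J').+1%:R *: (dlog j J' L * L^`M(c))
  else L^`M(j).

Section LogDerivatives.
Variables (k : fieldType) (n : nat) (j : 'I_n).
Implicit Types (L A B : {mpoly k[n]}) (J : seq 'I_n).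

Lemma mderiv_exp A m c : (A ^+ m.+1)^`M(c) = m.+1%:R *: (A ^+ m * A^`M(c)).
Proof.
elim: m => [|m IH]; first by rewrite expr1 expr0 mul1r scale1r.
rewrite exprS mderivM IH -!mul_mpolyC !mpolyC_nat.
by rewrite -[in RHS]natr1 !exprS; move: (m.+1%:R) (A^`M(c)) => r d; ring.
Qed.

(** Additivity of the logarithm, multiplied by the power of A B that clears the denominators. *)
Lemma dlogM J A B :
  dlog j J (A * B) =
  A ^+ (size J).+1 * dlog j J B + B ^+ (size J).+1 * dlog j J A.
Proof.
elim: J => [|c J IH] /=; first by rewrite mderivM !expr1 addrC (mulrC B).
rewrite IH; set m := size J; move: (dlog j J A) (dlog j J B) => a b.
rewrite mderivD !mderivM !mderiv_exp -!mul_mpolyC !mpolyC_nat.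
by rewrite !exprSr; ring.
Qed.

Lemma dlogC J (c : k) : dlog j J c%:MP = 0.
Proof.
elim: J => [|i J IH] /=; first by rewrite mderivC.
by rewrite IH mderiv0 mul0r mulr0 scaler0 subr0.
Qed.

Lemma dlogX J A a :
  dlog j J (A ^+ a.+1) = a.+1%:R *: (A ^+ (a * (size J).+1) * dlog j J A).
Proof.
elim: a => [|a IH]; first by rewrite expr1 mul0n expr0 mul1r scale1r.
rewrite exprS dlogM IH -!mul_mpolyC !mpolyC_nat -exprM mulSn exprD -[in RHS]natr1.
by move: (a.+1%:R) (dlog j J A) (A ^+ (size J).+1) (A ^+ (a * (size J).+1)) => r d x y; ring.
Qed.

Lemma dlog_lform (x : 'rV[k]_n) J :
  dlog j J (lform x) =
  ((-1) ^+ size J * (size J)`!%:R * (x ord0 j * \prod_(c <- J) x ord0 c))%:MP.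
Proof.
elim: J => [|c J IH] /=; first by rewrite mderiv_lform big_nil !mulr1 expr0 mul1r.
rewrite IH mderivC mulr0 add0r mderiv_lform -mpolyCM -mul_mpolyC -mpolyCM -mpolyCN.
by congr (_%:MP); rewrite big_cons factS natrM exprS; ring.
Qed.

(* L^(m+1) B(d) d_j (log L).  For L = prod l_x it is, up to a nonzero constant,
   sum_x x_j B(x) (L / l_x)^(m+1), and it is polynomial in the coefficients of L. *)
Definition dlog_pair (m : nat) B L :=
  \sum_(a : 'X_{1..n < m.+1} | mdeg a == m) B@_a *: dlog j (m2s a) L.

Lemma dlog_pairM m B A C :
  dlog_pair m B (A * C) =
  A ^+ m.+1 * dlog_pair m B C + C ^+ m.+1 * dlog_pair m B A.
Proof.
rewrite /dlog_pair !big_distrr -big_split; apply: eq_bigr => a /eqP am /=.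
by rewrite dlogM size_m2s am scalerDr !scalerAr.
Qed.

Lemma dlog_pairC m B (c : k) : dlog_pair m B c%:MP = 0.
Proof. by rewrite /dlog_pair big1 // => a _; rewrite dlogC scaler0. Qed.

Lemma dlog_pairX m B A a :
  dlog_pair m B (A ^+ a.+1) = a.+1%:R *: (A ^+ (a * m.+1) * dlog_pair m B A).
Proof.
rewrite /dlog_pair big_distrr scaler_sumr; apply: eq_bigr => i /eqP am /=.
by rewrite dlogX size_m2s am scalerA mulrC -scalerA scalerAr.
Qed.

Lemma dlog_pair_lform m B (x : 'rV[k]_n) : B \is m.-homog ->
  dlog_pair m B (lform x) = ((-1) ^+ m * m`!%:R * (x ord0 j * peval B x))%:MP.
Proof.
move=> hB; rewrite /peval [in RHS](mpolywE (k := m.+1) (p := B)); last first.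
  apply/bigmax_leqP_seq => a /(dhomog_mf hB) am _; by rewrite ltnS am.
rewrite raddf_sum /= !big_distrr rmorph_sum /= (bigID (fun a : 'X_{1..n < m.+1} => mdeg a == m)) /=.
rewrite [X in _ = _ + X]big1 ?addr0 => [|a ne]; last first.
  by rewrite (dhomog_nemf_coeff hB ne) scale0r meval0 !mulr0 mpolyC0.
apply: eq_bigr => a /eqP am; rewrite dlog_lform size_m2s am -mul_mpolyC -mpolyCM.
congr (_%:MP); rewrite mevalZ mevalX mulrCA; congr (_ * _); rewrite mulrCA; congr (_ * (_ * _)).
rewrite /m2s big_flatten big_map big_enum /=; apply: eq_bigr => i _.
by rewrite big_nseq iter_mulr mulr1.
Qed.

Lemma dlog_pair_prod m B (s : seq 'rV[k]_n) : B \is m.-homog ->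
  (forall x, x \in s -> peval B x = 0) ->
  dlog_pair m B (\prod_(x <- s) lform x) = 0.
Proof.
move=> hB; elim: s => [|x s IH] Bs.
  by rewrite big_nil -[1]mpolyC1 dlog_pairC.
rewrite big_cons dlog_pairM IH => [|y ys]; last by rewrite Bs // inE ys orbT.
by rewrite dlog_pair_lform // Bs ?mem_head // !mulr0 ?mpolyC0 ?mulr0 addr0.
Qed.

Lemma dlog_pair_scale_prod m B c (s : seq 'rV[k]_n) : B \is m.-homog ->
  (forall x, x \in s -> peval B x = 0) ->
  dlog_pair m B (c *: \prod_(x <- s) lform x) = 0.
Proof.
by move=> hB Bs; rewrite -mul_mpolyC dlog_pairM dlog_pair_prod // dlog_pairC !mulr0 addr0.
Qed.

(* log (l_x^(a+1) N) = (a+1) log l_x + log N, and N is invertible at u: the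
   pole along l_x = 0 has coefficient (a+1) x_j B(x), where a+1 <> 0 in k. *)
Lemma dlog_pair_mult m B (x : 'rV[k]_n) a N u : [pchar k] =i pred0 -> B \is m.-homog ->
  peval (lform x) u = 0 -> peval N u != 0 ->
  dlog_pair m B (lform x ^+ a.+1 * N) = 0 -> x ord0 j * peval B x = 0.
Proof.
move=> ch0 hB xu Nu; have [->|x0] := eqVneq x 0; first by rewrite mxE mul0r.
have l0 : lform x != 0 by rewrite lform_eq0.
rewrite dlog_pairM dlog_pairX -exprM mulSn exprD mulnC.
set S := dlog_pair m B (lform x); set S' := dlog_pair m B N.
have -> : lform x ^+ m.+1 * lform x ^+ (m.+1 * a) * S' +
   N ^+ m.+1 * (a.+1%:R *: (lform x ^+ (m.+1 * a) * S)) =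
   lform x ^+ (m.+1 * a) * (lform x ^+ m.+1 * S' + a.+1%:R *: (N ^+ m.+1 * S)).
  by rewrite -!mul_mpolyC; ring.
move/eqP; rewrite mulf_eq0 expf_eq0 (negPf l0) andbF /= => /eqP/(congr1 (fun p => peval p u)).
rewrite /= pevalD pevalM pevalXn xu expr0n mul0r add0r peval0 pevalZ pevalM pevalXn.
rewrite /S dlog_pair_lform // pevalC => /eqP.
have nat0 i : (i.+1%:R : k) != 0 by move/(pcharf0P k): ch0 => ->.
rewrite !mulf_eq0 expf_eq0 (negPf Nu) (negPf (nat0 a)) signr_eq0 andbF /=.
have [f ->] : exists f, m`! = f.+1 by exists m`!.-1; rewrite prednK // fact_gt0.
by rewrite (negPf (nat0 f)) /= => /orP[]/eqP->; rewrite ?mul0r ?mulr0.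
Qed.

End LogDerivatives.

(** * Chow forms *)

Lemma lform_prime_prod (k : closedFieldType) n (y : 'rV[k]_n) (s : seq 'rV[k]_n) c :
  y != 0 -> c != 0 ->
  (forall u, peval (lform y) u = 0 -> peval (c *: \prod_(x <- s) lform x) u = 0) ->
  exists2 x, x \in s & forall u, peval (lform y) u = 0 -> peval (lform x) u = 0.
Proof.
move=> y0 c0; elim: s => [|x s IH] h.
  have := h 0; rewrite big_nil pevalZ peval1 mulr1 -[0](scale0r (0 : 'rV[k]_n)) lformZ mul0r.
  by move=> /(_ erefl) e; rewrite e eqxx in c0.
have [u yu||[M E]] := @lform_prime _ _ y (lform x) (c *: \prod_(x <- s) lform x) y0.
- by have := h _ yu; rewrite big_cons scalerAr.
- by case=> M E; exists x; rewrite ?mem_head // => u yu; rewrite E pevalM yu mulr0.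
have [u yu|z zs hz] := IH; first by rewrite E pevalM yu mulr0.
by exists z; rewrite // inE zs orbT.
Qed.

Lemma lform_proportional (k : closedFieldType) n (x y : 'rV[k]_n) :
  x != 0 -> y != 0 ->
  (forall u, peval (lform y) u = 0 -> peval (lform x) u = 0) ->
  exists2 c, c != 0 & x = c *: y.
Proof.
move=> x0 y0 /(lform_dvd y0)[M E].
have [_ _ /(_ _ _ E)[|]] := lform_irreducible x0; last first.
  by have [_ /negPf->] := lform_irreducible y0.
rewrite mpoly_unitE => /msize_poly1P[c c0 ME]; exists c => //.
apply/rowP => i; rewrite -mcoeff_lform E ME mul_mpolyC mcoeffZ mcoeff_lform.
by rewrite mxE.
Qed.

Definition chow_poly (k : fieldType) (r N e : nat) (p : 'rV[k]_(chow_ncoord r N e)) :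
    {mpoly k[r.+1 * N]} :=
  \sum_i p ord0 i *: 'X_[bmnm (enum_val (A := chow_monom r N e) i)].

Lemma chow_homog_mdeg (k : fieldType) (r N e : nat) (R : {mpoly k[r.+1 * N]}) m :
  chow_homog e R -> m \in msupp R -> mdeg m = (r.+1 * e)%N.
Proof.
move=> hR mR; rewrite mdegE (reindex _ (curry_mxvec_bij _ _)) /=.
rewrite (eq_bigr (fun p => m (mxvec_index p.1 p.2))) => [|[i j] _ //].
rewrite -(pair_bigA _ (fun i j => m (mxvec_index i j))) /=.
rewrite (eq_bigr (fun=> e)) => [|i _]; last exact: hR.
by rewrite sum_nat_const card_ord.
Qed.

Lemma chow_poly_scale (k : fieldType) (r N e : nat) c (p : 'rV[k]_(chow_ncoord r N e)) :
  chow_poly (c *: p) = c *: chow_poly p.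
Proof. by rewrite scaler_sumr; apply: eq_bigr => i _; rewrite mxE scalerA. Qed.

Lemma coef_rowK (k : fieldType) (r N e : nat) (R : {mpoly k[r.+1 * N]}) :
  chow_homog e R -> chow_poly (coef_row e R) = R.
Proof.
move=> hR; rewrite /chow_poly [RHS](mpolywE (k := (r.+1 * e).+1)); last first.
  by apply/bigmax_leqP_seq => m mR _; rewrite -(chow_homog_mdeg hR mR).
rewrite [RHS](reindex_onto (enum_val (A := chow_monom r N e)) enum_rank) /=.
  by apply: eq_big => [i|i _]; rewrite ?enum_valK ?eqxx // mxE.
by move=> i _; rewrite enum_rankK.
Qed.

Section ChowForm.
Variables (k : closedFieldType) (r N : nat).
Implicit Types (V : pset k N) (R : {mpoly k[r.+1 * N]}) (u v : 'M[k]_(r.+1, N)).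

(** The incidence half of [is_chow_form]. Unlike irreducibility, it survives for the product of the
    Chow forms of the components, with V the whole support. *)
Definition chow_zeros V R := forall u,
  meval_mx R u = 0 <-> exists2 x, V x & forall i, \sum_j u i j * x ord0 j = 0.

Lemma chow_nonzero V R : R != 0 -> chow_zeros V R -> exists u, meval_mx R u != 0.
Proof.
move=> /peval_neq0[x xR] _; exists (vec_mx x).
by rewrite /meval_mx vec_mxK.
Qed.

(* Replacing hyperplanes by combinations does not change their common zeros, so
   all but one of them can be made to pass through x0. *)
Lemma chow_move V R (x0 : 'rV[k]_N) u j :
  chow_zeros V R -> meval_mx R u != 0 -> \sum_l u j l * x0 ord0 l != 0 ->
  exists v, meval_mx R v != 0 /\
    forall i, i != ord0 -> \sum_l v i l * x0 ord0 l = 0.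
Proof.
(* The hyperplane missing x0 is moved to row 0 and serves as pivot for the other rows. *)
move=> zR Ru uj; pose w : 'M[k]_(r.+1, N) := xrow ord0 j u.
pose d (i : 'I_r.+1) (x : 'rV[k]_N) : k := \sum_l w i l * x ord0 l.
have dE i (x : 'rV[k]_N) : d i x = \sum_l u (tperm ord0 j i) l * x ord0 l.
  by apply: eq_bigr => l _; rewrite !mxE.
have d0 : d ord0 x0 != 0 by rewrite dE tpermL.
pose v := \matrix_(i, l) (w i l - (if i == ord0 then 0 else d i x0 / d ord0 x0) * w ord0 l).
have vE i (x : 'rV[k]_N) : \sum_l v i l * x ord0 l =
    d i x - (if i == ord0 then 0 else d i x0 / d ord0 x0) * d ord0 x.
  rewrite {3}/d big_distrr {1}/d -sumrB; apply: eq_bigr => l _.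
  by rewrite [v i l]mxE mulrBl /= mulrA.
exists v; split=> [|i /negPf i0]; last by rewrite vE i0 divfK // subrr.
apply: contra Ru => /eqP/zR[x Vx vx]; apply/eqP/zR; exists x => // i.
have dx0 : d ord0 x = 0 by have := vx ord0; rewrite vE eqxx mul0r subr0.
have dx l : d l x = 0 by have := vx l; rewrite vE dx0 mulr0 subr0.
by have := dx (tperm ord0 j i); rewrite dE tpermK.
Qed.

(** A generic hyperplane in row 0 above the fixed rows of v; substituted into a Chow form, it yields
    the form L of the overview. *)
Definition Lmx v : 'M[{mpoly k[N]}]_(r.+1, N) :=
  \matrix_(i, j) if i == ord0 then 'X_j else (v i j)%:MP.

Definition Lpoly v R : {mpoly k[N]} := R \mPo [tuple mxvec (Lmx v) ord0 i | i < r.+1 * N].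

Definition setrow0 v (x : 'rV[k]_N) : 'M[k]_(r.+1, N) :=
  \matrix_(i, j) if i == ord0 then x ord0 j else v i j.

Lemma peval_mxcomp m (M : 'M[{mpoly k[m]}]_(r.+1, N)) R (x : 'rV[k]_m) :
  peval (R \mPo [tuple mxvec M ord0 i | i < r.+1 * N]) x =
  meval_mx R (map_mx (fun p => peval p x) M).
Proof.
rewrite peval_comp /meval_mx; congr peval; apply/rowP => i.
by rewrite mxE tnth_mktuple -map_mxvec mxE.
Qed.

Lemma peval_Lpoly v R x : peval (Lpoly v R) x = meval_mx R (setrow0 v x).
Proof.
rewrite peval_mxcomp; congr meval_mx; apply/matrixP => i j; rewrite !mxE.
by case: ifP => _; rewrite ?pevalXU ?pevalC.
Qed.

Lemma setrow0_dot v x (y : 'rV[k]_N) i :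
  \sum_j setrow0 v x i j * y ord0 j =
  if i == ord0 then peval (lform y) x else \sum_l v i l * y ord0 l.
Proof.
case: ifP => i0.
  by rewrite lform_sym peval_lform; apply: eq_bigr => j _; rewrite mxE i0.
by apply: eq_bigr => j _; rewrite mxE i0.
Qed.

Lemma Lpoly_zeros V R v : chow_zeros V R -> forall x,
  peval (Lpoly v R) x = 0 <->
  exists2 y, V y /\ (forall i, i != ord0 -> \sum_l v i l * y ord0 l = 0) &
    peval (lform y) x = 0.
Proof.
move=> zR x; rewrite peval_Lpoly; split=> [/zR[y Vy h]|[y [Vy h] yx]].
  exists y; last by have := h ord0; rewrite setrow0_dot eqxx.
  by split=> // i /negPf i0; have := h i; rewrite setrow0_dot i0.
apply/zR; exists y => // i; rewrite setrow0_dot.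
by case: ifP => // /negbT/h.
Qed.

Lemma setrow0_id v : setrow0 v (row ord0 v) = v.
Proof. by apply/matrixP => i j; rewrite !mxE; case: eqP => [->|]. Qed.

(** All hyperplanes but the first can be moved through y. As a function of the first one, the Chow
    form is then a product of l_x with x in V; were it 0 on all hyperplanes through y, y would be
    proportional to one of these x. *)
Lemma chow_avoid V R (y : 'rV[k]_N) : R != 0 -> chow_zeros V R ->
  (forall x, V x -> x != 0) ->
  (forall c x, c != 0 -> V x -> V (c *: x)) -> y != 0 -> ~ V y ->
  exists u, meval_mx R u != 0 /\ forall i, \sum_l u i l * y ord0 l = 0.
Proof.
move=> R0 zR V0 Vs y0 nVy; have [u Ru] := chow_nonzero R0 zR.
have [|] := boolP [forall i, \sum_l u i l * y ord0 l == 0].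
  by move=> /forallP h; exists u; split=> // i; apply/eqP.
rewrite negb_forall => /existsP[j uj].
have [v [Rv vy]] := chow_move zR Ru uj.
have L0 : Lpoly v R != 0.
  by apply: contraNneq Rv => h; rewrite -(setrow0_id v) -peval_Lpoly h peval0.
have [s [c [sV LE]]] := factor_lforms L0 (fun x h => V0 x (proj1 h)) (Lpoly_zeros v zR).
have c0 : c != 0 by apply: contraNneq L0 => h; rewrite LE h scale0r.
case: (classic (exists x, peval (lform y) x = 0 /\ peval (Lpoly v R) x != 0)) => [[x [yx Lx]]|no].
  exists (setrow0 v x); rewrite -peval_Lpoly; split=> // i.
  by rewrite setrow0_dot; case: ifP => // /negbT/vy.
have [x yx|x xs xy] := lform_prime_prod (s := s) y0 c0.
  by rewrite -LE; apply/eqP/negPn/negP => h; apply: no; exists x.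
have [b b0 xE] := lform_proportional (V0 _ (proj1 (sV _ xs))) y0 xy.
case: nVy; have -> : y = b^-1 *: x by rewrite xE scalerA mulVf // scale1r.
by apply: Vs; rewrite ?invr_eq0 //; case: (sV _ xs).
Qed.

End ChowForm.

Section PointData.
Variables (k : closedFieldType) (N : nat).
Implicit Types (V : pset k N).

Lemma pclosed_neq0 V x : pclosed V -> V x -> x != 0.
Proof. by move=> [S [_ h]] /h[]. Qed.

Lemma pclosed_scale V c x : pclosed V -> c != 0 -> V x -> V (c *: x).
Proof.
move=> [S [hS h]] c0 /h[x0 Sx]; apply/h; split=> [|Q SQ].
  by rewrite scaler_eq0 negb_or c0.
by have [e he] := hS _ SQ; rewrite (peval_homogZ _ _ he) Sx ?mulr0.
Qed.

Lemma chow_pointP (r e : nat) (Z : alg_cycle k N) (p : 'rV[k]_(chow_ncoord r N e)) :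
  chow_point Z p ->
  [/\ p != 0, chow_homog e (chow_poly p), chow_poly p != 0 &
      chow_zeros (csupp Z) (chow_poly p)].
Proof.
move=> [[Zc _] [Rs [hRs hR [p0 q0 [c c0 pE]]]]].
set R := \prod_i _ in hR q0 pE.
have RE : chow_poly p = c *: R by rewrite pE chow_poly_scale coef_rowK.
have R0 : R != 0.
  apply/prodf_neq0 => i _; rewrite expf_neq0 //.
  by case: (hRs i) => -[].
have msuppR m : m \in msupp (c *: R) -> m \in msupp R by apply: msuppZ_le.
split; rewrite ?RE ?scaler_eq0 ?negb_or ?c0 //; first by move=> m /msuppR; apply: hR.
move=> u; rewrite /meval_mx pevalZ.
have -> : c * peval R (mxvec u) = 0 <-> peval R (mxvec u) = 0.
  split=> [/eqP|->]; last by rewrite mulr0.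
  by rewrite mulf_eq0 (negPf c0) => /eqP.
rewrite /R peval_prod; split=> [/eqP|[x [i Zx] ux]].
  rewrite prodf_seq_eq0 => /hasP[i _ /=]; rewrite pevalXn expf_eq0 => /andP[_ /eqP].
  by have [_ h] := hRs i => /h[x Zx ux]; exists x => //; exists i.
rewrite (bigD1 i) //= pevalXn; have [_ h] := hRs i.
have -> : peval (Rs i) (mxvec u) = 0 by apply/h; exists x.
by have [m0 _ _] := Zc i; rewrite expr0n gtn_eqF // mul0r.
Qed.

Lemma csupp_neq0 (r e : nat) (Z : alg_cycle k N) (p : 'rV[k]_(chow_ncoord r N e)) x :
  chow_point Z p -> csupp Z x -> x != 0.
Proof. by move=> [[Zc _] _] [i Zx]; have [_ [cl _ _] _] := Zc i; apply: pclosed_neq0 cl Zx. Qed.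

Lemma csupp_scale (r e : nat) (Z : alg_cycle k N) (p : 'rV[k]_(chow_ncoord r N e)) c x :
  chow_point Z p -> c != 0 -> csupp Z x -> csupp Z (c *: x).
Proof.
move=> [[Zc _] _] c0 [i Zx]; exists i; have [_ [cl _ _] _] := Zc i.
exact: pclosed_scale.
Qed.

End PointData.

(** * Bihomogeneous functions *)

Lemma dhomog_comp (k : fieldType) m n e D (p : {mpoly k[m]}) (s : 'I_m -> {mpoly k[n]}) :
  p \is e.-homog -> (forall i, s i \is D.-homog) ->
  p \mPo [tuple s i | i < m] \is (D * e).-homog.
Proof.
move=> /dhomogP hp hs; rewrite comp_mpolyEX big_seq; apply: rpred_sum => a /hp <-.
apply: rpredZ; rewrite comp_mpolyX /= mdegE big_distrr /=.
elim/big_rec2: _ => [|i q r _ hr]; first exact: dhomog1.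
by apply: dhomogM => //; rewrite tnth_mktuple; apply: dhomogMn.
Qed.

Section Biforms.
Variables (k : fieldType) (a b : nat).
Implicit Types (f g : 'rV[k]_a -> 'rV[k]_b -> k).

Definition is_biform e1 e2 f :=
  exists2 Q : {mpoly k[a + b]}, bihomog e1 e2 Q &
    forall x y, f x y = peval Q (row_mx x y).

Lemma biform_ext e1 e2 f g : (forall x y, f x y = g x y) ->
  is_biform e1 e2 f -> is_biform e1 e2 g.
Proof. by move=> fg [Q hQ E]; exists Q => // x y; rewrite -fg. Qed.

Lemma biform0 e1 e2 : is_biform e1 e2 (fun _ _ => 0).
Proof. by exists 0 => [m|x y]; rewrite ?msupp0 // peval0. Qed.

Lemma biformD e1 e2 f g : is_biform e1 e2 f -> is_biform e1 e2 g ->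
  is_biform e1 e2 (fun x y => f x y + g x y).
Proof.
move=> [Q hQ fQ] [Q' hQ' gQ]; exists (Q + Q') => [m /msuppD_le|x y].
  by rewrite mem_cat => /orP[/hQ|/hQ'].
by rewrite fQ gQ pevalD.
Qed.

Lemma biformM e1 e2 e3 e4 f g : is_biform e1 e2 f -> is_biform e3 e4 g ->
  is_biform (e1 + e3) (e2 + e4) (fun x y => f x y * g x y).
Proof.
move=> [Q hQ fQ] [Q' hQ' gQ]; exists (Q * Q') => [m|x y]; last by rewrite fQ gQ pevalM.
case/msuppM_le/allpairsP=> /= -[m1 m2] [/= /hQ[h1 h2] /hQ'[h3 h4] ->].
by rewrite -h1 -h2 -h3 -h4 -!big_split; split; apply: eq_bigr => i _; rewrite mnmDE.
Qed.

Lemma biformC c : is_biform 0 0 (fun _ _ => c).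
Proof.
exists c%:MP => [m|x y]; last by rewrite pevalC.
rewrite msuppC; case: ifP => // _; rewrite inE => /eqP->.
by split; apply: big1 => i _; rewrite mnm0E.
Qed.

Lemma biformXl i : is_biform 1 0 (fun x _ => x ord0 i).
Proof.
exists 'X_(lshift b i) => [m|x y]; last by rewrite pevalXU row_mxEl.
rewrite msuppX inE => /eqP->; split.
  rewrite (bigD1 i) //= mnm1E eqxx big1 // => j ne.
  by rewrite mnm1E (inj_eq (@lshift_inj _ _)) eq_sym (negPf ne).
by apply: big1 => j _; rewrite mnm1E eq_lrshift.
Qed.

Lemma biformXr i : is_biform 0 1 (fun _ y => y ord0 i).
Proof.
exists 'X_(rshift a i) => [m|x y]; last by rewrite pevalXU row_mxEr.
rewrite msuppX inE => /eqP->; split.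
  by apply: big1 => j _; rewrite mnm1E eq_rlshift.
rewrite (bigD1 i) //= mnm1E eqxx big1 // => j ne.
by rewrite mnm1E (inj_eq (@rshift_inj _ _)) eq_sym (negPf ne).
Qed.

Lemma biform_sum e1 e2 (I : Type) (r : seq I) (P : pred I) (F : I -> 'rV[k]_a -> 'rV[k]_b -> k) :
  (forall i, P i -> is_biform e1 e2 (F i)) ->
  is_biform e1 e2 (fun x y => \sum_(i <- r | P i) F i x y).
Proof.
move=> h; elim: r => [|i r IH].
  by apply: biform_ext (biform0 _ _) => x y; rewrite big_nil.
have [Pi|nPi] := boolP (P i).
  by apply: biform_ext (biformD (h _ Pi) IH) => x y; rewrite big_cons Pi.
by apply: biform_ext IH => x y; rewrite big_cons (negPf nPi).
Qed.

Lemma biform_scale_r e1 e2 f c x y : is_biform e1 e2 f ->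
  f x (c *: y) = c ^+ e2 * f x y.
Proof.
move=> [Q hQ fQ]; rewrite !fQ /peval !mevalE big_distrr /= !big_seq.
apply: eq_bigr => m /hQ[_ h2]; rewrite mulrCA; congr (_ * _).
rewrite !big_split_ord /= mulrCA; congr (_ * _).
  by apply: eq_bigr => i _; rewrite !row_mxEl.
rewrite -h2 -prodrXr -big_split; apply: eq_bigr => i _ /=.
by rewrite !row_mxEr mxE exprMn.
Qed.

(** Serves to pull the separating equation back along local formulas for [Psi] and, with b = 0, to
    extract a form from a function of bidegree (D, 0). *)
Lemma biform_subst e1 e2 f (g : nat) (P : 'I_b -> {mpoly k[a]}) :
  is_biform e1 e2 f -> (forall j, P j \is g.-homog) ->
  exists2 R : {mpoly k[a]}, R \is (e1 + e2 * g).-homog &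
    forall x, peval R x = f x (forms_at P x).
Proof.
move=> [Q hQ fQ] hP.
pose s (i : 'I_(a + b)) := match split i with inl i => 'X_i | inr j => P j end.
have sl i : s (lshift b i) = 'X_i by rewrite /s (unsplitK (inl i)).
have sr j : s (rshift a j) = P j by rewrite /s (unsplitK (inr j)).
exists (Q \mPo [tuple s i | i < a + b]).
  rewrite comp_mpolyEX big_seq; apply: rpred_sum => m /hQ[h1 h2]; apply: rpredZ.
  rewrite comp_mpolyX big_split_ord /=; apply: dhomogM.
    rewrite -h1; elim/big_rec2: _ => [|i p q _ hq]; first exact: dhomog1.
    by apply: dhomogM => //; rewrite tnth_mktuple sl mpolyXn dhomogX /= mdegMn mdeg1 mul1n.
  rewrite -h2 big_distrl /=; elim/big_rec2: _ => [|i p q _ hq]; first exact: dhomog1.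
  by apply: dhomogM => //; rewrite tnth_mktuple sr mulnC; apply: dhomogMn.
move=> x; rewrite peval_comp fQ; congr peval; apply/rowP => i; rewrite mxE tnth_mktuple.
case: (split_ordP i) => j ->; first by rewrite sl pevalXU row_mxEl.
by rewrite sr row_mxEr mxE.
Qed.

Section Families.
Variable N : nat.
Implicit Types (G H : 'rV[k]_a -> 'rV[k]_b -> {mpoly k[N]}).

(* Polynomials whose coefficients are forms of bidegree (e1, e2). *)
Inductive fam e1 e2 : ('rV[k]_a -> 'rV[k]_b -> {mpoly k[N]}) -> Prop :=
| FamNil G of (forall x y, G x y = 0) : fam e1 e2 G
| FamCons c P G H of is_biform e1 e2 c & fam e1 e2 G &
    (forall x y, H x y = c x y *: P + G x y) : fam e1 e2 H.

Lemma fam_ext e1 e2 G H : (forall x y, G x y = H x y) -> fam e1 e2 G -> fam e1 e2 H.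
Proof.
move=> GH hG; case: hG GH => [{}G h|c P G1 {}G hc hG1 h] GH.
  by apply: FamNil => x y; rewrite -GH.
by apply: FamCons hc hG1 _ => x y; rewrite -GH.
Qed.

Lemma fam_term e1 e2 c P : is_biform e1 e2 c -> fam e1 e2 (fun x y => c x y *: P).
Proof.
move=> hc; apply: FamCons hc (FamNil _ _ (fun _ _ => erefl)) _ => x y.
by rewrite /= addr0.
Qed.

Lemma famD e1 e2 G H : fam e1 e2 G -> fam e1 e2 H ->
  fam e1 e2 (fun x y => G x y + H x y).
Proof.
move=> hG hH; elim: hG => {G} [G h|c P G1 G hc _ IH h].
  by apply: fam_ext hH => x y; rewrite h add0r.
by apply: FamCons hc IH _ => x y; rewrite h addrA.
Qed.

Lemma fam_sum e1 e2 (I : Type) (r : seq I) F : (forall i, fam e1 e2 (F i)) ->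
  fam e1 e2 (fun x y => \sum_(i <- r) F i x y).
Proof.
move=> h; elim: r => [|i r IH]; first by apply: FamNil => x y; rewrite big_nil.
by apply: fam_ext (famD (h i) IH) => x y; rewrite big_cons.
Qed.

Lemma fam_form e1 e2 G (phi : {mpoly k[N]} -> k) :
  (forall c p q, phi (c *: p + q) = c * phi p + phi q) ->
  fam e1 e2 G -> is_biform e1 e2 (fun x y => phi (G x y)).
Proof.
move=> hphi; have phi0 : phi 0 = 0.
  by have := hphi (-1) 0 0; rewrite scaler0 addr0 mulN1r addNr.
elim=> {G} [G h|c P G1 G hc _ IH h].
  by apply: biform_ext (biform0 _ _) => x y; rewrite h phi0.
have hcP : is_biform e1 e2 (fun x y => c x y * phi P).
  by rewrite -[e1]addn0 -[e2]addn0; apply: biformM hc (biformC _).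
by apply: biform_ext (biformD hcP IH) => x y; rewrite h hphi.
Qed.

End Families.

Lemma fam_linear N N' e1 e2 (G : 'rV[k]_a -> 'rV[k]_b -> {mpoly k[N]})
    (phi : {mpoly k[N]} -> {mpoly k[N']}) :
  (forall c p q, phi (c *: p + q) = c *: phi p + phi q) ->
  fam e1 e2 G -> fam e1 e2 (fun x y => phi (G x y)).
Proof.
move=> hphi; have phi0 : phi 0 = 0.
  by have := hphi (-1) 0 0; rewrite scaler0 addr0 scaleN1r addNr.
elim=> {G} [G h|c P G1 G hc _ IH h].
  by apply: FamNil => x y; rewrite h phi0.
by apply: FamCons hc IH _ => x y; rewrite h hphi.
Qed.

Section FamilyProducts.
Variable N : nat.
Implicit Types (G H : 'rV[k]_a -> 'rV[k]_b -> {mpoly k[N]}).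

Lemma famZ e1 e2 e3 e4 c G : is_biform e1 e2 c -> fam e3 e4 G ->
  fam (e1 + e3) (e2 + e4) (fun x y => c x y *: G x y).
Proof.
move=> hc; elim=> {G} [G h|c' P G1 G hc' _ IH h].
  by apply: FamNil => x y; rewrite h scaler0.
apply: FamCons (biformM hc hc') IH _ => x y.
by rewrite h scalerDr scalerA.
Qed.

Lemma famM e1 e2 e3 e4 G H : fam e1 e2 G -> fam e3 e4 H ->
  fam (e1 + e3) (e2 + e4) (fun x y => G x y * H x y).
Proof.
move=> hG hH; elim: hG => {G} [G h|c P G1 G hc _ IH h].
  by apply: FamNil => x y; rewrite h mul0r.
have hPH : fam e3 e4 (fun x y => P * H x y).
  by apply: fam_linear hH => d p q; rewrite mulrDr scalerAr.
apply: fam_ext (famD (famZ hc hPH) IH) => x y.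
by rewrite h mulrDl scalerAl.
Qed.

Lemma famC P : fam 0 0 (fun _ _ => P : {mpoly k[N]}).
Proof. by apply: fam_ext (fam_term P (biformC 1)) => x y; rewrite scale1r. Qed.

Lemma famX e1 e2 G m : fam e1 e2 G -> fam (e1 * m) (e2 * m) (fun x y => G x y ^+ m).
Proof.
move=> hG; elim: m => [|m IH].
  by rewrite !muln0; apply: fam_ext (famC 1) => x y; rewrite expr0.
by rewrite !mulnS; apply: fam_ext (famM hG IH) => x y; rewrite exprS.
Qed.

Lemma fam_dlog e1 e2 G j J : fam e1 e2 G ->
  fam ((size J).+1 * e1) ((size J).+1 * e2) (fun x y => dlog j J (G x y)).
Proof.
move=> hG; elim: J => [|c J IH] /=.
  by rewrite !mul1n; apply: fam_linear hG => d p q; rewrite mderivD mderivZ.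
have dG H (i1 i2 : nat) : fam i1 i2 H -> fam i1 i2 (fun x y => (H x y)^`M(c)).
  by apply: fam_linear => d p q; rewrite mderivD mderivZ.
have h1 := famM hG (dG _ _ _ IH); have h2 := famM IH (dG _ _ _ hG).
have h3 := fam_linear (phi := fun p => - (size J).+1%:R *: p) _ h2.
rewrite !(addnC (_ * _)%N) -!mulSn in h3; rewrite -!mulSn in h1.
apply: fam_ext (famD h1 (h3 _)) => [x y|d p q]; first by rewrite scaleNr.
by rewrite scalerDr !scalerA mulrC.
Qed.

End FamilyProducts.
End Biforms.

(** * The separating equation *)

Lemma lform_multiplicity (k : closedFieldType) n (x : 'rV[k]_n) (L : {mpoly k[n]}) :
  x != 0 -> L != 0 ->
  exists a N, L = lform x ^+ a * N /\ ~ exists M, N = M * lform x.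
Proof.
move=> x0; have [m] := ubnP (msize L); elim: m L => // m IH L lt L0.
case: (classic (exists M, L = M * lform x)) => [[M E]|no]; last first.
  by exists 0, L; rewrite expr0 mul1r.
have := L0; rewrite E mulf_eq0 negb_or => /andP[M0 l0].
have [|a [N [ME h]]] := IH M _ M0.
  by move: lt; rewrite E msizeM // msize_lform // addn2.
by exists a.+1, N; rewrite {1}ME exprSr mulrAC.
Qed.

Section Pullback.
Variables (k : closedFieldType) (r N N' : nat).
Variables (u : 'M[k]_(r.+1, N')) (w : 'rV[k]_N') (Q : 'I_N' -> {mpoly k[N]}).
Implicit Types (R : {mpoly k[r.+1 * N']}).

Definition qdot (z : 'rV[k]_N') : {mpoly k[N]} := \sum_l z ord0 l *: Q l.

Lemma peval_qdot z x : peval (qdot z) x = peval (lform z) (forms_at Q x).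
Proof.
by rewrite peval_sum peval_lform; apply: eq_bigr => l _; rewrite pevalZ mxE.
Qed.

Definition pull_mx : 'M[{mpoly k[N]}]_(r.+1, N') :=
  \matrix_(i, j) (u i j *: qdot w - w ord0 j *: qdot (row i u)).

(* The i-th hyperplane <w, y> u_i - <u_i, y> w contains y, for y = Q(x). *)
Definition pull R : {mpoly k[N]} :=
  R \mPo [tuple mxvec pull_mx ord0 i | i < r.+1 * N'].

Lemma peval_pull R x (y := forms_at Q x) :
  peval (pull R) x = meval_mx R
    (\matrix_(i, j) (u i j * peval (lform w) y - w ord0 j * peval (lform (row i u)) y)).
Proof.
rewrite peval_mxcomp; congr meval_mx; apply/matrixP => i j; rewrite !mxE.
by rewrite pevalB !pevalZ !peval_qdot.
Qed.

Lemma pull_zero V R x : chow_zeros V R -> (exists z, V z) ->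
  forms_at Q x = 0 \/ V (forms_at Q x) -> peval (pull R) x = 0.
Proof.
move=> zR [z Vz] Qx; rewrite peval_pull; apply/zR.
(* If Q(x) = 0, the moved hyperplanes all have zero coefficients, and any point of V satisfies
   them. *)
case: Qx => [->|Vy]; [exists z|exists (forms_at Q x)] => // i.
  apply: big1 => l _; rewrite mxE -(scale0r (0 : 'rV[k]_N')) !lformZ.
  by rewrite !mul0r !mulr0 subrr mul0r.
set y := forms_at Q x.
transitivity (\sum_l (peval (lform w) y * (u i l * y ord0 l) -
   peval (lform (row i u)) y * (w ord0 l * y ord0 l))).
  by apply: eq_bigr => l _; rewrite mxE; ring.
rewrite sumrB -!big_distrr /= -(peval_lform w) mulrC.
suff -> : \sum_l u i l * y ord0 l = peval (lform (row i u)) y by rewrite subrr.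
by rewrite peval_lform; apply: eq_bigr => l _; rewrite [row i u _ _]mxE.
Qed.

Lemma pull_neq0 R x : peval (lform w) (forms_at Q x) = 1 ->
  (forall i, \sum_l u i l * forms_at Q x ord0 l = 0) ->
  peval (pull R) x = meval_mx R u.
Proof.
move=> w1 u0; rewrite peval_pull; congr meval_mx; apply/matrixP => i j.
have e : peval (lform (row i u)) (forms_at Q x) = 0.
  by rewrite peval_lform -[RHS](u0 i); apply: eq_bigr => l _; rewrite [row i u _ _]mxE.
by rewrite mxE w1 mulr1 e mulr0 subr0.
Qed.

Lemma dhomog_pull R e D : (forall l, Q l \is D.-homog) -> chow_homog e R ->
  pull R \is (D * (r.+1 * e)).-homog.
Proof.
move=> hQ hR; apply: dhomog_comp => [|i].
  by apply/dhomogP => m /(chow_homog_mdeg hR).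
case/mxvec_indexP: i => i j; rewrite mxvecE mxE.
by apply: rpredB; apply: rpredZ; apply: rpred_sum => l _; apply: rpredZ; apply: hQ.
Qed.

End Pullback.

Lemma fam_chow_l (k : fieldType) (r N e b N' : nat) (t : (r.+1 * N).-tuple {mpoly k[N']}) :
  fam (a := chow_ncoord r N e) (b := b) 1 0 (fun q _ => chow_poly q \mPo t).
Proof.
apply: (@fam_linear k _ b _ _ _ _ (fun q _ => chow_poly q)) => [c p q|].
  by rewrite raddfD /= comp_mpolyZ.
by apply: fam_sum => i; apply/fam_term/biformXl.
Qed.

Lemma fam_chow_r (k : fieldType) (r N e a N' : nat) (t : (r.+1 * N).-tuple {mpoly k[N']}) :
  fam (a := a) (b := chow_ncoord r N e) 0 1 (fun _ q => chow_poly q \mPo t).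
Proof.
apply: (@fam_linear k a _ _ _ _ _ (fun _ q => chow_poly q)) => [c p q|].
  by rewrite raddfD /= comp_mpolyZ.
by apply: fam_sum => i; apply/fam_term/biformXr.
Qed.

Lemma biform_dlog_pair (k : fieldType) a b N (j : 'I_N) m t
    (L B : 'rV[k]_a -> 'rV[k]_b -> {mpoly k[N]}) :
  fam 1 0 L -> fam 0 1 B ->
  is_biform m.+1 1 (fun x y => peval (dlog_pair j m (B x y) (L x y)) t).
Proof.
move=> hL hB; apply: (@biform_ext _ _ _ _ _ (fun x y =>
  \sum_(i : 'X_{1..N < m.+1} | mdeg i == m)
    (B x y)@_i * peval (dlog j (m2s i) (L x y)) t)) => [x y|].
  by rewrite /dlog_pair peval_sum; apply: eq_bigr => i _; rewrite pevalZ.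
apply: biform_sum => i /eqP im.
have hBi : is_biform 0 1 (fun x y => (B x y)@_i).
  by apply: fam_form hB => c p q; rewrite mcoeffD mcoeffZ.
suff hLi : is_biform m.+1 0 (fun x y => peval (dlog j (m2s i) (L x y)) t).
  exact: (biformM hBi hLi).
have := fam_dlog j (m2s i) hL; rewrite size_m2s im muln1 muln0.
by apply: (fam_form (phi := fun p => peval p t)) => c p q; rewrite pevalD pevalZ.
Qed.

(** The auxiliary hyperplanes u, v, w are chosen from (p, p') and F and then kept fixed while q, q'
    vary; this is why the vanishing of [pull] on V1 is asked for every u and w. The degree 1 in q'
    comes from the linearity of B in q'. *)
Lemma separating_biform (k : closedFieldType) (r N N' e e' D : nat)
    (V : pset k N) (V' : pset k N') (Q : 'I_N' -> {mpoly k[N]})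
    (p : 'rV[k]_(chow_ncoord r N e)) (p' : 'rV[k]_(chow_ncoord r N' e')) F :
  [pchar k] =i pred0 -> (forall l, Q l \is D.-homog) ->
  chow_poly p != 0 -> chow_zeros V (chow_poly p) ->
  chow_poly p' != 0 -> chow_homog e' (chow_poly p') ->
  chow_zeros V' (chow_poly p') -> (forall x, V' x -> x != 0) ->
  (forall c x, c != 0 -> V' x -> V' (c *: x)) ->
  V F -> F != 0 -> forms_at Q F != 0 -> ~ V' (forms_at Q F) ->
  exists e1 W, [/\ is_biform e1 1 W, W p p' != 0 &
    forall q q' (V1 : pset k N),
      chow_zeros V1 (chow_poly q) -> (forall x, V1 x -> x != 0) ->
      chow_homog e' (chow_poly q') ->
      (forall (u : 'M_(r.+1, N')) w x,
         V1 x -> peval (pull u w Q (chow_poly q')) x = 0) ->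
      W q q' = 0].
Proof.
move=> ch0 hQ p0 zp p'0 hp' zp' V'0 V's VF F0 y0 nV'y.
set y := forms_at Q F in y0 nV'y.
have [u [Ru uy]] := chow_avoid p'0 zp' V'0 V's y0 nV'y.
have [w wy] : exists w, peval (lform w) y = 1.
  have [b yb] : exists b, peval (lform y) b != 0 by apply: peval_neq0; rewrite lform_eq0.
  by exists ((peval (lform y) b)^-1 *: b); rewrite lform_sym lformZ mulVf.
have [v [Rv vF]] : exists v, meval_mx (chow_poly p) v != 0 /\
    forall i, i != ord0 -> \sum_l v i l * F ord0 l = 0.
  have [v Rv] := chow_nonzero p0 zp.
  have [/forallP h|] := boolP [forall i, \sum_l v i l * F ord0 l == 0].
    by case/eqP: Rv; apply/zp; exists F => // i; apply/eqP.
  by rewrite negb_forall => /existsP[j]; apply: chow_move zp Rv.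
have [j Fj] : exists j, F ord0 j != 0.
  apply: NNPP => h; case/eqP: F0; apply/rowP => j; rewrite mxE.
  by apply/eqP/negPn/negP => Fj; apply: h; exists j.
pose m := (D * (r.+1 * e'))%N.
pose L q := Lpoly v (chow_poly (N := N) (e := e) q).
pose B q' := pull u w Q (chow_poly (e := e') q').
have hB q' : chow_homog e' (chow_poly q') -> B q' \is m.-homog by apply: dhomog_pull.
have [t Wt] : exists t, peval (dlog_pair j m (B p') (L p)) t != 0.
  apply: peval_neq0; apply/eqP => W0.
  have L0 : L p != 0.
    by apply: contraNneq Rv => h; rewrite -(setrow0_id v) -peval_Lpoly -/(L p) h peval0.
  have lL z : peval (lform F) z = 0 -> peval (L p) z = 0.
    by move=> Fz; apply/(Lpoly_zeros v zp); exists F.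
  (* The multiplicity of l_F in L is positive, because the hyperplanes in the rows of v other than
     row 0 all pass through F, a point of V. *)
  have [[|a] [M [LE nM]]] := lform_multiplicity F0 L0.
    by case: nM; apply: lform_dvd => // z /lL; rewrite LE expr0 mul1r.
  have [z [Fz Mz]] : exists z, peval (lform F) z = 0 /\ peval M z != 0.
    apply: NNPP => h; case: nM; apply: lform_dvd => // z Fz.
    by apply/eqP/negPn/negP => Mz; apply: h; exists z.
  rewrite LE in W0; have /eqP := dlog_pair_mult ch0 (hB _ hp') Fz Mz W0.
  by rewrite mulf_eq0 (negPf Fj) /B pull_neq0 // (negPf Ru).
exists m.+1, (fun q q' => peval (dlog_pair j m (B q') (L q)) t); split=> //.
  by apply: biform_dlog_pair; [apply: fam_chow_l | apply: fam_chow_r].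
move=> q q' V1 zq V10 hq' h.
(* For special q the chosen hyperplanes may meet the support badly and L is 0; so are then its
   logarithmic expressions with cleared denominators. *)
have [L0|L0] := eqVneq (L q) 0.
  by rewrite L0 -mpolyC0 dlog_pairC peval0.
have [s [c [sV LE]]] := factor_lforms L0 (fun x h => V10 x (proj1 h)) (Lpoly_zeros v zq).
rewrite LE dlog_pair_scale_prod ?peval0 ?hB // => x /sV[V1x _].
exact: h.
Qed.

(** * Binary forms *)

(** The homogeneous components of p l_x are those of p times l_x, so a component of p in a wrong
    degree is annihilated by l_x. *)
Lemma dhomog_factor_lform (k : fieldType) n e (x : 'rV[k]_n) (p : {mpoly k[n]}) :
  x != 0 -> p * lform x \is e.+1.-homog -> p \is e.-homog.
Proof.
move=> x0 hp; have l0 : lform x != 0 by rewrite lform_eq0.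
have pi i : pihomog mdeg i.+1 (p * lform x) = pihomog mdeg i p * lform x.
  have hi j : pihomog mdeg j p * lform x \is j.+1.-homog.
    by rewrite -addn1; apply: dhomogM (pihomogP _ _ _) (dhomog_lform x).
  rewrite {1}(pihomog_partitionE (leqnn (msize p))) mulr_suml raddf_sum /=.
  have [lt|le] := ltnP i (msize p).
    rewrite (bigD1 (Ordinal lt)) //= pihomog_dE // big1 ?addr0 // => j ne.
    by apply: (pihomog_ne0 _ (hi j)); rewrite eqSS.
  rewrite big1 => [|j _]; last first.
    by apply: (pihomog_ne0 _ (hi j)); rewrite eqSS neq_ltn (leq_trans (ltn_ord j)).
  rewrite pihomogE big1_seq ?mul0r // => m /andP[/eqP mi mp].
  by have := msize_mdeg_lt mp; rewrite mi ltnNge le.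
rewrite (pihomog_partitionE (leqnn (msize p))); apply: rpred_sum => i _.
have [<-|ne] := eqVneq (i : nat) e; first exact: pihomogP.
have : pihomog mdeg i p * lform x = 0.
  by rewrite -pi; apply: (pihomog_ne0 _ hp); rewrite eqSS eq_sym.
by move/eqP; rewrite mulf_eq0 (negPf l0) orbF => /eqP->; apply: rpred0.
Qed.

Definition perp (k : fieldType) (c : 'rV[k]_2) : 'rV[k]_2 :=
  \row_i if i == ord0 then c ord0 ord_max else - c ord0 ord0.

Section BinaryForms.
Variable k : closedFieldType.
Implicit Types (c x y : 'rV[k]_2) (p q r s h : {mpoly k[2]}).

Lemma sum2 (V : zmodType) (F : 'I_2 -> V) : \sum_i F i = F ord0 + F ord_max.
Proof. by rewrite big_ord_recl big_ord1; congr (_ + F _); apply: val_inj. Qed.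

Lemma ord2P (P : 'I_2 -> Prop) : P ord0 -> P ord_max -> forall i, P i.
Proof.
move=> h0 h1 [[|[|//]] h]; first by rewrite (_ : Ordinal h = ord0) //; apply: val_inj.
by rewrite (_ : Ordinal h = ord_max) //; apply: val_inj.
Qed.

Lemma row2_eq0 x : x ord0 ord0 = 0 -> x ord0 ord_max = 0 -> x = 0.
Proof. by move=> h0 h1; apply/rowP; apply: ord2P; rewrite mxE. Qed.

Lemma linear_form_atE c : linear_form_at c = lform (perp c).
Proof. by rewrite /lform sum2 !mxE eqxx /= scaleNr. Qed.

Lemma perp_eq0 c : (perp c == 0) = (c == 0).
Proof.
apply/eqP/eqP => [h|->]; last by apply/rowP => i; rewrite !mxE oppr0 if_same.
have := congr1 (fun z : 'rV_2 => z ord0 ord0) h; rewrite !mxE eqxx => h1.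
have := congr1 (fun z : 'rV_2 => z ord0 ord_max) h; rewrite !mxE /= => /eqP.
by rewrite oppr_eq0 => /eqP h0; apply: row2_eq0.
Qed.

Lemma peval_linear_form_at c x :
  peval (linear_form_at c) x = c ord0 ord_max * x ord0 ord0 - c ord0 ord0 * x ord0 ord_max.
Proof. by rewrite pevalB !pevalZ !pevalXU. Qed.

Lemma linear_form_at_zero c x : c != 0 -> peval (linear_form_at c) x = 0 ->
  exists t, x = t *: c.
Proof.
rewrite peval_linear_form_at => c0 /eqP; rewrite subr_eq0 => /eqP e.
have [c00|c00] := eqVneq (c ord0 ord0) 0.
  have c1 : c ord0 ord_max != 0 by apply: contraNneq c0 => c1; apply/eqP/row2_eq0.
  exists (x ord0 ord_max / c ord0 ord_max); apply/rowP; apply: ord2P; rewrite !mxE ?divfK //.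
  move/eqP: e; rewrite c00 mul0r mulf_eq0 (negPf c1) /= => /eqP->.
  by rewrite mulr0.
exists (x ord0 ord0 / c ord0 ord0); apply/rowP; apply: ord2P; rewrite !mxE ?divfK //.
by apply: (mulfI c00); rewrite -e; field.
Qed.

Lemma linear_form_at_neq0 c : c != 0 -> linear_form_at c != 0.
Proof. by rewrite linear_form_atE lform_eq0 perp_eq0. Qed.

Lemma linear_form_at_self c : peval (linear_form_at c) c = 0.
Proof. by rewrite peval_linear_form_at mulrC subrr. Qed.

Lemma binary_root e p c : p \is e.-homog -> c != 0 -> peval p c = 0 ->
  exists2 q, p = linear_form_at c * q & q \is e.-1.-homog.
Proof.
move=> hp c0 pc; have c0' : perp c != 0 by rewrite perp_eq0.
have [u|M E] := @lform_dvd _ _ (perp c) p c0'.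
  rewrite -linear_form_atE => /(linear_form_at_zero c0)[t ->].
  by rewrite (peval_homogZ _ _ hp) pc mulr0.
case: e hp => [|e] hp; last first.
  exists M; first by rewrite linear_form_atE mulrC.
  by apply: (dhomog_factor_lform c0'); rewrite -E.
(* In degree 0 a form with a zero is 0. *)
exists 0; last exact: rpred0.
rewrite mulr0; apply: peval_all0 => x.
have := peval_homogZ 0 x hp; have := peval_homogZ 0 c hp.
by rewrite !scale0r expr0 !mul1r pc => -> ->.
Qed.

(** Without a zero off the origin, h is constant on each line through a = (1, 0) that misses the
    origin. These lines reach every point with nonzero second coordinate, so h is a nonzero
    constant. *)
Lemma nonunit_zero h : h \isn't a GRing.unit -> exists2 x : 'rV[k]_2, x != 0 & peval h x = 0.
Proof.
move=> hu; apply: NNPP => no.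
have nz x : x != 0 -> peval h x != 0.
  by move=> x0; apply/negP => /eqP hx; apply: no; exists x.
pose a : 'rV[k]_2 := \row_i (i == ord0)%:R.
have a0 : a ord0 ord0 = 1 by rewrite mxE eqxx.
have a1 : a ord0 ord_max = 0 by rewrite mxE.
have na : a != 0.
  by apply/eqP => e; move: a0; rewrite e mxE => /esym/eqP; rewrite oner_eq0.
have ha y : y ord0 ord_max != 0 -> peval h y = peval h a.
  move=> y1; pose b := y - a.
  have hb t : a + t *: b = 0 -> False.
    move=> e; have := congr1 (fun z : 'rV_2 => z ord0 ord_max) e.
    have := congr1 (fun z : 'rV_2 => z ord0 ord0) e.
    rewrite !mxE /= subr0 add0r => e0 /eqP; rewrite mulf_eq0 (negPf y1) orbF => /eqP t0.
    by move/eqP: e0; rewrite t0 mul0r addr0 oner_eq0.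
  have [/size_poly1P[c _ cE]|/closed_rootP[t]] := boolP (size (line b a h) == 1).
    have e t : peval h (a + t *: b) = c by rewrite -horner_line cE hornerC.
    have := e 1; rewrite scale1r addrC subrK => ->.
    by have := e 0; rewrite scale0r addr0.
  rewrite rootE horner_line => /eqP h0.
  by have /nz/eqP := introN eqP (@hb t).
have : (h - (peval h a)%:MP) * 'X_ord_max = 0.
  apply: peval_all0 => y; rewrite pevalM pevalB pevalC pevalXU.
  have [->|y1] := eqVneq (y ord0 ord_max) 0; first by rewrite mulr0.
  by rewrite ha // subrr mul0r.
move/eqP; rewrite mulf_eq0 => /orP[|/eqP X0]; last first.
  have := pevalXU (ord_max : 'I_2) (const_mx 1 : 'rV[k]_2).
  by rewrite X0 peval0 mxE => /esym/eqP; rewrite oner_eq0.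
rewrite subr_eq0 => /eqP hE; case/negP: hu.
by rewrite hE rmorph_unit // unitfE nz.
Qed.

Definition no_common_zero (g : 'I_2 -> {mpoly k[2]}) :=
  forall x, x != 0 -> eval_pair g x != 0.

Lemma eval_pair_eq0 (g : 'I_2 -> {mpoly k[2]}) x :
  (forall j, peval (g j) x = 0) -> eval_pair g x = 0.
Proof. by move=> h; apply/rowP => j; rewrite !mxE h. Qed.

Lemma common_zero (g : 'I_2 -> {mpoly k[2]}) : ~ no_common_zero g ->
  exists2 x, x != 0 & forall j, peval (g j) x = 0.
Proof.
move=> cz; apply: NNPP => no; apply: cz => x x0; apply/negP => /eqP gx.
apply: no; exists x => // j.
by have := congr1 (fun z : 'rV_2 => z ord0 j) gx; rewrite !mxE.
Qed.

Lemma coprime_formsP d (g : 'I_2 -> {mpoly k[2]}) : (forall j, g j \is d.-homog) ->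
  coprime_forms g <-> no_common_zero g.
Proof.
move=> hg; split=> [cop x x0|ncz h hd].
  apply/negP => /eqP gx; have gj j : peval (g j) x = 0.
    by have := congr1 (fun z : 'rV_2 => z ord0 j) gx; rewrite !mxE.
  have := cop (linear_form_at x).
  rewrite linear_form_atE mpoly_unitE msize_lform ?perp_eq0 // => h.
  suff : (2 == 1)%N by [].
  apply: h => j; have [q E _] := binary_root (hg j) x0 (gj j).
  by exists q; rewrite -linear_form_atE.
apply/negPn/negP => /nonunit_zero[x x0 hx]; have := ncz x x0.
rewrite eval_pair_eq0 ?eqxx // => j; have [q ->] := hd j.
by rewrite pevalM hx mul0r.
Qed.

Lemma gcd_forms d (f : 'I_2 -> {mpoly k[2]}) : (forall j, f j \is d.-homog) ->
  (exists j, f j != 0) ->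
  exists h g dh dg, [/\ forall j, f j = h * g j, h \is dh.-homog,
    forall j, g j \is dg.-homog, no_common_zero g & h != 0].
Proof.
elim: d f => [|d IH] f hf [j0 fj0];
  (case: (classic (no_common_zero f)) => [ncz|/common_zero[x x0 fx]];
   first by exists 1, f, 0%N; eexists; split;
     [move=> j; rewrite mul1r | apply: dhomog1 | apply: hf | | apply: oner_neq0]).
  have [q E hq] := binary_root (hf j0) x0 (fx j0).
  case/eqP: fj0; apply: peval_all0 => y.
  have := peval_homogZ 0 y (hf j0); have := peval_homogZ 0 x (hf j0).
  by rewrite !scale0r expr0 !mul1r fx => -> ->.
have /fin_all_exists2[f' fE hf'] := fun j => binary_root (hf j) x0 (fx j).
have [|h [g [dh [dg [gE hh hg ncz h0]]]]] := IH f' hf'.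
  by exists j0; apply: contraNneq fj0 => e; rewrite fE e mulr0.
exists (linear_form_at x * h), g, (1 + dh)%N, dg; split=> //.
- by move=> j; rewrite fE gE mulrA.
- by apply: dhomogM => //; rewrite linear_form_atE dhomog_lform.
- by rewrite mulf_neq0 // linear_form_at_neq0.
Qed.

(** A binary form splits into linear factors, and in a domain one of the substituted factors must be
    0. *)
Lemma comp_zero_direction e q (P : 'I_2 -> {mpoly k[2]}) :
  q \is e.-homog -> q != 0 -> q \mPo [tuple P i | i < 2] = 0 ->
  exists c, [/\ c != 0, peval q c = 0 & linear_form_at c \mPo [tuple P i | i < 2] = 0].
Proof.
elim: e q => [|e IH] q hq q0 qP.
  have [qu|/nonunit_zero[x x0 qx]] := boolP (q \is a GRing.unit).
    move: qu; rewrite mpoly_unitE => /msize_poly1P[c c0 qE].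
    by move/eqP: qP; rewrite qE comp_mpolyC mpolyC_eq0 (negPf c0).
  case/eqP: q0; apply: peval_all0 => y.
  have := peval_homogZ 0 y hq; have := peval_homogZ 0 x hq.
  by rewrite !scale0r expr0 !mul1r qx => -> ->.
have [qu|/nonunit_zero[c c0 qc]] := boolP (q \is a GRing.unit).
  move: qu; rewrite mpoly_unitE => /msize_poly1P[c c0 qE].
  by move/eqP: qP; rewrite qE comp_mpolyC mpolyC_eq0 (negPf c0).
have [q' qE hq'] := binary_root hq c0 qc.
move: qP; rewrite qE rmorphM => /eqP; rewrite mulf_eq0 => /orP[/eqP lP|/eqP q'P].
  by exists c; split=> //; rewrite pevalM linear_form_at_self mul0r.
have q'0 : q' != 0 by apply: contraNneq q0 => e0; rewrite qE e0 mulr0.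
have [c' [c'0 h lP]] := IH q' hq' q'0 q'P.
by exists c'; split=> //; rewrite pevalM h mulr0.
Qed.

(** At a root of p, q does not vanish, so r does; the roots of p are cancelled from p and r one at a
    time. *)
Lemma cross_dvd e1 e2 p q r s : p \is e1.-homog -> r \is e2.-homog -> p != 0 ->
  (forall x, x != 0 -> peval p x = 0 -> peval q x != 0) ->
  p * s = q * r -> exists t, r = p * t.
Proof.
elim: e1 e2 p r => [|e1 IH] e2 p r hp hr p0 pq E.
  have [pu|/nonunit_zero[x x0 px]] := boolP (p \is a GRing.unit).
    by exists (p^-1 * r); rewrite mulVKr.
  case/eqP: p0; apply: peval_all0 => y.
  have := peval_homogZ 0 y hp; have := peval_homogZ 0 x hp.
  by rewrite !scale0r expr0 !mul1r px => -> ->.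
have [pu|/nonunit_zero[x x0 px]] := boolP (p \is a GRing.unit).
  by exists (p^-1 * r); rewrite mulVKr.
have rx : peval r x = 0.
  have /eqP : peval (q * r) x = 0 by rewrite -E pevalM px mul0r.
  by rewrite pevalM mulf_eq0 (negPf (pq x x0 px)) => /eqP.
have [p' pE hp'] := binary_root hp x0 px; have [r' rE hr'] := binary_root hr x0 rx.
have l0 := linear_form_at_neq0 x0.
have [|y y0 p'y||t r'E] := IH _ p' r' hp' hr'.
- by apply: contraNneq p0 => e; rewrite pE e mulr0.
- by apply: pq; rewrite // pE pevalM p'y mulr0.
- by apply: (mulfI l0); rewrite mulrA -pE E rE; ring.
by exists t; rewrite rE pE r'E mulrA.
Qed.

Lemma same_map_scalar d1 d2 (g h : 'I_2 -> {mpoly k[2]}) :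
  (forall j, g j \is d1.-homog) -> (forall j, h j \is d2.-homog) ->
  no_common_zero g -> no_common_zero h ->
  (forall x, x != 0 -> peq (eval_pair g x) (eval_pair h x)) ->
  exists2 c, c != 0 & forall j, h j = c *: g j.
Proof.
move=> hg hh ng nh gh.
have E i j : g i * h j = g j * h i.
  apply/eqP; rewrite -subr_eq0; set A := _ - _.
  (* The two maps are compared only at nonzero x; the factor 'X_0 takes care of the origin. *)
  have : A * 'X_ord0 = 0.
    apply: peval_all0 => x; rewrite pevalM pevalXU.
    have [->|/gh[_ _ [c _ gE]]] := eqVneq x 0; first by rewrite mxE mulr0.
    have gl l : peval (g l) x = c * peval (h l) x.
      by have := congr1 (fun z : 'rV_2 => z ord0 l) gE; rewrite !mxE.
    by rewrite pevalB !pevalM !gl; ring.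
  move/eqP; rewrite mulf_eq0 => /orP[//|/eqP X0].
  have := pevalXU (ord0 : 'I_2) (const_mx 1 : 'rV[k]_2).
  by rewrite X0 peval0 mxE => /esym/eqP; rewrite oner_eq0.
have other (i : 'I_2) : exists j, forall l, l = i \/ l = j.
  by move: i; apply: ord2P; [exists ord_max | exists ord0]; apply: ord2P; auto.
have [i gi0] : exists i, g i != 0.
  apply: NNPP => no; have := ng (const_mx 1); rewrite eval_pair_eq0 ?eqxx => [h1|j].
    suff : false by []. apply: h1; apply/eqP => /rowP/(_ ord0)/eqP.
    by rewrite !mxE oner_eq0.
  have [->|ne] := eqVneq (g j) 0; first by rewrite peval0.
  by case: no; exists j.
have [j ij] := other i.
have pq x : x != 0 -> peval (g i) x = 0 -> peval (g j) x != 0.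
  move=> x0 gx; apply: contraNneq (ng x x0) => gx'; rewrite eval_pair_eq0 // => l.
  by case: (ij l) => ->.
have [t hi] := cross_dvd (hg i) (hh i) gi0 pq (E i j).
have ht l : h l = g l * t by apply: (mulfI gi0); rewrite E hi mulrCA mulrA.
have [tu|/nonunit_zero[x x0 tx]] := boolP (t \is a GRing.unit).
  move: tu; rewrite mpoly_unitE => /msize_poly1P[c c0 tE].
  by exists c => // l; rewrite ht tE mulrC mul_mpolyC.
have := nh x x0; rewrite eval_pair_eq0 ?eqxx // => l.
by rewrite ht pevalM tx mulr0.
Qed.

End BinaryForms.

(** * Iteration of rational maps *)

Section RationalMaps.
Variable k : closedFieldType.

Lemma mdeg_bmonom d i : (i <= d)%N -> mdeg (bmonom d i) = d.
Proof. by move=> le; rewrite mdegD !mdegMn !mdeg1 !mul1n subnK. Qed.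

Lemma bmonom_ord0 d i : bmonom d i ord0 = (d - i)%N.
Proof. by rewrite mnmDE !mulmnE !mnm1E eqxx mul1n mul0n addn0. Qed.

Lemma bmonom_ord_max d i : bmonom d i ord_max = i.
Proof. by rewrite mnmDE !mulmnE !mnm1E eqxx mul1n mul0n add0n. Qed.

Lemma bmonom_inj d i j : bmonom d i = bmonom d j -> i = j.
Proof. by move/mnmP/(_ ord_max); rewrite !bmonom_ord_max. Qed.

Lemma mcoeff_bform d (a : 'rV[k]_d.+1) (i : 'I_d.+1) :
  (bform a)@_(bmonom d i) = a ord0 i.
Proof.
rewrite raddf_sum (bigD1 i) //= mcoeffZ mcoeffX eqxx mulr1 big1 ?addr0 // => j ne.
rewrite mcoeffZ mcoeffX; case: eqP => [/bmonom_inj e|]; last by rewrite mulr0.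
by case/eqP: ne; apply: val_inj.
Qed.

Lemma bformK d : cancel (@bform k d) (@brow k d).
Proof. by move=> a; apply/rowP => i; rewrite mxE mcoeff_bform. Qed.

Lemma dhomog_bform d (a : 'rV[k]_d.+1) : bform a \is d.-homog.
Proof.
apply: rpred_sum => i _; apply: rpredZ.
by rewrite dhomogX /= mdeg_bmonom // -ltnS.
Qed.

Lemma browK d (p : {mpoly k[2]}) : p \is d.-homog -> bform (brow d p) = p.
Proof.
move=> hp; apply/mpolyP => m; have [hm|hm] := eqVneq (mdeg m) d; last first.
  by rewrite (dhomog_nemf_coeff hp hm) (dhomog_nemf_coeff (dhomog_bform _) hm).
have le : (m ord_max < d.+1)%N.
  by rewrite ltnS -hm mdegE (bigD1 ord_max) //= leq_addr.
have -> : m = bmonom d (Ordinal le).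
  apply/mnmP; apply: ord2P; rewrite ?bmonom_ord0 ?bmonom_ord_max //=.
  rewrite -hm mdegE big_ord_recl big_ord1.
  by rewrite (_ : lift ord0 ord0 = ord_max) ?addnK //; apply: val_inj.
by rewrite mcoeff_bform mxE.
Qed.

Lemma dhomog_rform d (F : 'rV[k]_(ratdim d)) j : rform F j \is d.-homog.
Proof. by rewrite /rform; case: ifP => _; apply: dhomog_bform. Qed.

Lemma rform_row_mx d (p : 'I_2 -> {mpoly k[2]}) : (forall j, p j \is d.-homog) ->
  forall j, rform (row_mx (brow d (p ord0)) (brow d (p ord_max)) : 'rV_(ratdim d)) j = p j.
Proof.
move=> hp; apply: ord2P; rewrite /rform /= ?eqxx.
  by rewrite row_mxKl browK.
by rewrite row_mxKr browK.
Qed.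

Lemma rform_inj d (F G : 'rV[k]_(ratdim d)) : (forall j, rform F j = rform G j) -> F = G.
Proof.
move=> e; rewrite -(hsubmxK F) -(hsubmxK G).
have := e ord0; have := e ord_max; rewrite /rform /= => e1 e0.
by rewrite -(bformK (lsubmx F)) -(bformK (rsubmx F)) e0 e1 !bformK.
Qed.

Lemma bformZ d c (a : 'rV[k]_d.+1) : bform (c *: a) = c *: bform a.
Proof. by rewrite scaler_sumr; apply: eq_bigr => i _; rewrite mxE scalerA. Qed.

Lemma rformZ d c (F : 'rV[k]_(ratdim d)) j : rform (c *: F) j = c *: rform F j.
Proof.
rewrite /rform; case: ifP => _; rewrite -bformZ; congr bform;
  by apply/rowP => i; rewrite !mxE.
Qed.

Lemma eval_rformZ d c (F : 'rV[k]_(ratdim d)) x :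
  eval_pair (rform (c *: F)) x = c *: eval_pair (rform F) x.
Proof. by apply/rowP => j; rewrite !mxE rformZ pevalZ. Qed.

Lemma rform_neq0 d (F : 'rV[k]_(ratdim d)) : F != 0 -> exists j, rform F j != 0.
Proof.
move=> F0; apply: NNPP => no; case/eqP: F0; rewrite -[F]scale1r -[RHS](scale0r F).
apply: rform_inj => j; rewrite !rformZ scale0r.
by have [->|ne] := eqVneq (rform F j) 0; [rewrite scaler0 | case: no; exists j].
Qed.

Lemma RatP d (F : 'rV[k]_(ratdim d)) : Defs.Rat F <-> no_common_zero (rform F).
Proof. exact: coprime_formsP (dhomog_rform F). Qed.

Lemma Rat_neq0 d (F : 'rV[k]_(ratdim d)) : Defs.Rat F -> F != 0.
Proof.
move=> /RatP h; have : (const_mx 1 : 'rV[k]_2) != 0.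
  by apply/eqP => /rowP/(_ ord0)/eqP; rewrite !mxE oner_eq0.
move=> /h; apply: contraNneq => ->; rewrite eval_pair_eq0 // => j.
by rewrite -[0](scale0r 0) rformZ scale0r peval0.
Qed.

Lemma peqP N (x y : 'rV[k]_N) c : c != 0 -> y != 0 -> x = c *: y -> peq x y.
Proof. by move=> c0 y0 E; split=> //; [rewrite E scaler_eq0 negb_or c0 | exists c]. Qed.

Lemma peq_sym N (x y : 'rV[k]_N) : peq x y -> peq y x.
Proof.
move=> [x0 y0 [c c0 E]]; apply: (@peqP _ _ _ c^-1) => //; first by rewrite invr_eq0.
by rewrite E scalerA mulVf // scale1r.
Qed.

Lemma peq_trans N (x y z : 'rV[k]_N) : peq x y -> peq y z -> peq x z.
Proof.
move=> [x0 y0 [c c0 E]] [_ z0 [d d0 E']]; apply: (@peqP _ _ _ (c * d)) => //.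
  by rewrite mulf_neq0.
by rewrite E E' scalerA.
Qed.

Lemma peq_refl N (x : 'rV[k]_N) : x != 0 -> peq x x.
Proof. by move=> x0; apply: (@peqP _ _ _ 1); rewrite ?oner_neq0 ?scale1r. Qed.

Lemma same_map_peq d (F G : 'rV[k]_(ratdim d)) : Defs.Rat F -> Defs.Rat G ->
  (forall x, x != 0 -> peq (eval_pair (rform F) x) (eval_pair (rform G) x)) ->
  peq F G.
Proof.
move=> hF hG FG; have [c c0 e] := same_map_scalar (dhomog_rform F) (dhomog_rform G)
  (proj1 (RatP F) hF) (proj1 (RatP G) hG) FG.
apply: peq_sym; apply: (peqP c0); first exact: Rat_neq0.
by apply: rform_inj => j; rewrite rformZ e.
Qed.

Lemma is_iterate_peq d n (F : 'rV[k]_(ratdim d)) G H :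
  is_iterate (n := n) F G -> peq H G -> is_iterate F H.
Proof.
move=> [hF hG e] [H0 G0 [c c0 HE]].
have ev x : eval_pair (rform H) x = c *: eval_pair (rform G) x by rewrite HE eval_rformZ.
have ncz x : x != 0 -> eval_pair (rform H) x != 0.
  by move=> x0; rewrite ev scaler_eq0 negb_or c0 (proj1 (RatP G)).
split=> //; first exact/RatP.
move=> x x0; apply: peq_trans (e x x0); apply: (peqP c0) => //.
by case: (e x x0).
Qed.

Lemma is_iterate_uniq d n (F : 'rV[k]_(ratdim d)) G H :
  is_iterate (n := n) F G -> is_iterate F H -> peq G H.
Proof.
move=> [_ hG eG] [_ hH eH]; apply: same_map_peq => // x x0.
exact: peq_trans (eG x x0) (peq_sym (eH x x0)).
Qed.

Section Conjugation.
Variables (g : 'M[k]_2) (gu : g \in unitmx).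

Let ginv := [tuple \sum_(j < 2) invmx g i j *: ('X_j : {mpoly k[2]}) | i < 2].

Lemma rform_conj d (F : 'rV[k]_(ratdim d)) j :
  rform (conj_act g F) j = \sum_(l < 2) g j l *: (rform F l \mPo ginv).
Proof.
apply: (@rform_row_mx _ (fun j => \sum_(l < 2) g j l *: (rform F l \mPo ginv))) => {}j.
apply: rpred_sum => l _; apply: rpredZ; rewrite -{2}(mul1n d).
apply: dhomog_comp (dhomog_rform F l) _ => i.
by apply: rpred_sum => m _; apply: rpredZ; rewrite dhomogX /= mdeg1.
Qed.

Lemma eval_conj d (F : 'rV[k]_(ratdim d)) x :
  eval_pair (rform (conj_act g F)) x = eval_pair (rform F) (x *m (invmx g)^T) *m g^T.
Proof.
apply/rowP => j; rewrite !mxE rform_conj peval_sum; apply: eq_bigr => l _.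
rewrite pevalZ peval_comp !mxE mulrC; congr (peval _ _ * _).
apply/rowP => i; rewrite !mxE tnth_mktuple peval_sum.
by apply: eq_bigr => m _; rewrite pevalZ pevalXU mxE mulrC.
Qed.

Lemma mul_unit_neq0 (x : 'rV[k]_2) (h : 'M[k]_2) : h \in unitmx -> x != 0 -> x *m h != 0.
Proof.
by move=> hu; apply: contraNneq => e; rewrite -(mulmxK hu x) e mul0mx.
Qed.

Let gT : g^T \in unitmx. Proof. by rewrite unitmx_tr. Qed.
Let gV : (invmx g)^T \in unitmx. Proof. by rewrite unitmx_tr unitmx_inv. Qed.

Lemma Rat_conj d (F : 'rV[k]_(ratdim d)) : Defs.Rat F -> Defs.Rat (conj_act g F).
Proof.
move=> /RatP h; apply/RatP => x x0; rewrite eval_conj.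
by apply: mul_unit_neq0 => //; apply: h; apply: mul_unit_neq0.
Qed.

Lemma iter_conj d n (F : 'rV[k]_(ratdim d)) x :
  iter n (eval_pair (rform (conj_act g F))) x =
  iter n (eval_pair (rform F)) (x *m (invmx g)^T) *m g^T.
Proof.
have gg : (invmx g)^T *m g^T = 1%:M by rewrite -trmx_mul mulmxV // trmx1.
have gg' : g^T *m (invmx g)^T = 1%:M by rewrite -trmx_mul mulVmx // trmx1.
elim: n => [|n IH] /=; first by rewrite -mulmxA gg mulmx1.
by rewrite IH eval_conj -mulmxA gg' mulmx1.
Qed.

Lemma is_iterate_conj d n (F : 'rV[k]_(ratdim d)) G :
  is_iterate (n := n) F G -> is_iterate (n := n) (conj_act g F) (conj_act g G).
Proof.
move=> [hF hG e]; split; try exact: Rat_conj.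
move=> x x0; rewrite iter_conj eval_conj.
have [|y0 z0 [c c0 E]] := e (x *m (invmx g)^T); first exact: mul_unit_neq0.
apply: (peqP c0); first exact: mul_unit_neq0.
by rewrite E scalemxAl.
Qed.

End Conjugation.

(** Homogeneous iteration makes sense for every F, coprime or not, at the price that the result may
    be identically 0. *)
Fixpoint iter_form d (F : 'rV[k]_(ratdim d)) n (j : 'I_2) : {mpoly k[2]} :=
  if n is n'.+1 then rform F j \mPo [tuple iter_form F n' i | i < 2] else 'X_j.

Definition iter_row d n (F : 'rV[k]_(ratdim d)) : 'rV[k]_(ratdim (d ^ n)) :=
  row_mx (brow (d ^ n) (iter_form F n ord0)) (brow (d ^ n) (iter_form F n ord_max)).

Section Iterates.
Variable d : nat.
Implicit Types (F : 'rV[k]_(ratdim d)).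

Lemma dhomog_iter_form F n j : iter_form F n j \is (d ^ n).-homog.
Proof.
elim: n j => [|n IH] j /=; first by rewrite dhomogX /= mdeg1.
by rewrite expnS mulnC; apply: dhomog_comp (dhomog_rform F j) IH.
Qed.

Lemma rform_iter_row n F j : rform (iter_row n F) j = iter_form F n j.
Proof. by apply: rform_row_mx; apply: dhomog_iter_form. Qed.

Lemma eval_iter_form F n x :
  eval_pair (iter_form F n) x = iter n (eval_pair (rform F)) x.
Proof.
elim: n => [|n IH] /=; first by apply/rowP => j; rewrite mxE pevalXU.
apply/rowP => j; rewrite !mxE peval_comp -IH; congr peval; apply/rowP => i.
by rewrite !mxE tnth_mktuple.
Qed.

Lemma is_iterate_iter_row n F : Defs.Rat F -> is_iterate F (iter_row n F).
Proof.
move=> hF; have e x : eval_pair (rform (iter_row n F)) x = iter n (eval_pair (rform F)) x.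
  by rewrite -eval_iter_form; apply/rowP => j; rewrite !mxE rform_iter_row.
have nz x : x != 0 -> iter n (eval_pair (rform F)) x != 0.
  by move=> x0; elim: n {e} => //= n IH; apply: (proj1 (RatP F)).
split=> //; first by apply/RatP => x /nz; rewrite e.
by move=> x /nz h; rewrite e; apply: peq_refl.
Qed.

(** The next iterate is linear in the coefficients of the outer F and of degree d in the previous
    iterate, whence the recursion D -> 1 + D d. The second group of variables is empty. *)
Lemma fam_iter_form n : exists D, forall j,
  fam (a := ratdim d) (b := 0) D 0 (fun F _ => iter_form F n j).
Proof.
elim: n => [|n [D IH]]; first by exists 0%N => j; apply: famC.
exists (1 + D * d)%N => j /=.
have bf (s : 'I_d.+1 -> 'I_(ratdim d)) : fam (a := ratdim d) (b := 0) (1 + D * d) 0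
    (fun F _ => \sum_i F ord0 (s i) *:
       (iter_form F n ord0 ^+ (d - i) * iter_form F n ord_max ^+ i)).
  apply: fam_sum => i; apply: (@famZ _ _ _ _ 1 0 (D * d) 0).
    exact: biformXl.
  have := famM (famX (d - i) (IH ord0)) (famX i (IH ord_max)).
  by rewrite -mulnDr subnK // -ltnS.
have bE F (a : 'rV[k]_d.+1) : bform a \mPo [tuple iter_form F n i | i < 2] =
    \sum_i a ord0 i *: (iter_form F n ord0 ^+ (d - i) * iter_form F n ord_max ^+ i).
  rewrite /bform raddf_sum; apply: eq_bigr => i _ /=; rewrite comp_mpolyZ comp_mpolyX.
  rewrite big_ord_recl big_ord1 !tnth_mktuple (_ : lift ord0 ord0 = ord_max); last exact: val_inj.
  by rewrite bmonom_ord0 bmonom_ord_max.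
move: j; apply: ord2P.
  apply: fam_ext (bf (@lshift _ _)) => F _; rewrite /rform eqxx bE.
  by apply: eq_bigr => i _; rewrite mxE.
apply: fam_ext (bf (@rshift _ _)) => F _; rewrite /rform /= bE.
by apply: eq_bigr => i _; rewrite mxE.
Qed.

Lemma iter_row_forms n : exists (Q : 'I_(ratdim (d ^ n)) -> {mpoly k[ratdim d]}) D,
  (forall l, Q l \is D.-homog) /\ forall F, forms_at Q F = iter_row n F.
Proof.
have [D hD] := fam_iter_form n.
suff /fin_all_exists2[Q hQ QE] : forall l : 'I_(ratdim (d ^ n)),
    exists2 Q : {mpoly k[ratdim d]}, Q \is D.-homog &
      forall F, peval Q F = iter_row n F ord0 l.
  by exists Q, D; split=> // F; apply/rowP => l; rewrite mxE QE.
move=> l; have [m [j lE]] : exists m j, forall F, iter_row n F ord0 l = (iter_form F n j)@_m.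
  case: (split_ordP l) => i ->; exists (bmonom (d ^ n) i).
    by exists ord0 => F; rewrite row_mxEl mxE.
  by exists ord_max => F; rewrite row_mxEr mxE.
have hf : is_biform (b := 0) D 0 (fun F _ => (iter_form F n j)@_m).
  by apply: fam_form (hD j) => c p q; rewrite mcoeffD mcoeffZ.
have [R hR RE] := biform_subst (g := 0) (P := fun=> 0) hf (fun=> rpred0 _).
rewrite mul0n addn0 in hR.
by exists R => // F; rewrite RE lE.
Qed.

Lemma comp_linear_form_at c (P : 'I_2 -> {mpoly k[2]}) :
  linear_form_at c \mPo [tuple P i | i < 2] =
  c ord0 ord_max *: P ord0 - c ord0 ord0 *: P ord_max.
Proof.
rewrite raddfB /= !comp_mpolyZ !comp_mpolyXU.
by rewrite -!tnth_nth !tnth_mktuple.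
Qed.

(* The homogeneous iterates of F = h g do not vanish unless g is constant
   with value a root of h: an iterate proportional to a constant vector forces g
   to be constant. *)
Lemma iter_form_neq0 n F : F != 0 -> ~ indeterminacy_locus F ->
  exists j, iter_form F n j != 0.
Proof.
move=> F0 nI; have [j0 Fj0] := rform_neq0 F0.
have [h [g [dh [dg [FE hh hg ncz h0]]]]] :=
  gcd_forms (dhomog_rform F) (ex_intro _ j0 Fj0).
pose lg (c : 'rV[k]_2) := c ord0 ord_max *: g ord0 - c ord0 ord0 *: g ord_max.
have lgx (c x : 'rV[k]_2) : peval (lg c) x = peval (linear_form_at c) (eval_pair g x).
  by rewrite pevalB !pevalZ peval_linear_form_at !mxE.
have inI (c : 'rV[k]_2) : c != 0 -> lg c = 0 -> peval h c = 0 -> False.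
  move=> c0 lc hc; apply: nI; split=> //.
  have c0' : perp c != 0 by rewrite perp_eq0.
  have [[|a] [N [hE nN]]] := lform_multiplicity c0' h0.
    case: nN; have [q E _] := binary_root hh c0 hc; exists q.
    by move: hE; rewrite expr0 mul1r => <-; rewrite E linear_form_atE mulrC.
  exists h, g, c, a.+1; split=> //.
  - by split=> //; apply/(coprime_formsP hg).
  - move=> x x0; have [t E] : exists t, eval_pair g x = t *: c.
      by apply: linear_form_at_zero; rewrite // -lgx lc peval0.
    apply: (@peqP _ _ _ t) => //; apply: contraNneq (ncz x x0) => t0.
    by rewrite E t0 scale0r.
  - rewrite /is_ord linear_form_atE; split; first by exists N.
    case=> q E; apply: nN; exists q.
    have l1 : lform (perp c) ^+ a.+1 != 0 by rewrite expf_neq0 // lform_eq0.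
    by apply: (mulfI l1); rewrite -hE E exprSr -mulrA (mulrC q).
(* The second assertion feeds the induction: if h vanished on the iterate, one of its roots c would
   have its linear form vanish there, so g would be constant with value c, and F would lie in
   I(d). *)
suff [] : (exists j, iter_form F n j != 0) /\
    forall c, c != 0 -> linear_form_at c \mPo [tuple iter_form F n i | i < 2] = 0 ->
      lg c = 0 by [].
elim: n => [|n [[j1 P0] IH]].
  split; first by exists j0; rewrite -msize_poly_eq0 msizeX.
  move=> c c0; rewrite comp_linear_form_at /= => e.
  by have /eqP := linear_form_at_neq0 c0.
have hP : h \mPo [tuple iter_form F n i | i < 2] != 0.
  apply/eqP => hP; have [c [c0 hc lP]] := comp_zero_direction hh h0 hP.
  exact: inI c0 (IH c c0 lP) hc.
have PE j : iter_form F n.+1 j =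
    (h \mPo [tuple iter_form F n i | i < 2]) * (g j \mPo [tuple iter_form F n i | i < 2]).
  by rewrite /= FE rmorphM.
split.
  apply: NNPP => no; case/eqP: P0; apply: peval_all0 => x.
  have gP j : g j \mPo [tuple iter_form F n i | i < 2] = 0.
    have [e|ne] := eqVneq (iter_form F n.+1 j) 0; last by case: no; exists j.
    by move/eqP: e; rewrite PE mulf_eq0 (negPf hP) => /eqP.
  suff : eval_pair (iter_form F n) x = 0.
    by move/(congr1 (fun z : 'rV_2 => z ord0 j1)); rewrite !mxE.
  apply/eqP/negPn/negP => /ncz/eqP; apply; apply: eval_pair_eq0 => j.
  have := congr1 (fun p => peval p x) (gP j); rewrite /= peval_comp peval0 => <-.
  by congr peval; apply/rowP => i; rewrite !mxE tnth_mktuple.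
move=> c c0; rewrite comp_linear_form_at !PE !scalerAr -mulrBr => /eqP.
rewrite mulf_eq0 (negPf hP) /= => /eqP e.
have lgP : lg c \mPo [tuple iter_form F n i | i < 2] = 0.
  by rewrite /lg raddfB /= !comp_mpolyZ.
have [//|lg0] := eqVneq (lg c) 0.
have hlg : lg c \is dg.-homog by apply: rpredB; apply: rpredZ.
(* By induction g is constant with value c', where c' is a root of [lg c]. Evaluating [lg c] at c'
   shows that c' is proportional to c. *)
have [c' [c'0 qc' lP]] := comp_zero_direction hlg lg0 lgP.
have lc' := IH c' c'0 lP.
have [t tE] : exists t, eval_pair g c' = t *: c'.
  by apply: linear_form_at_zero; rewrite // -lgx lc' peval0.
have t0 : t != 0.
  by apply: contraNneq (ncz _ c'0) => t0; rewrite tE t0 scale0r.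
have lcc : peval (linear_form_at c) c' = 0.
  move: qc'; rewrite lgx tE linear_form_atE lformZ => /eqP.
  by rewrite mulf_eq0 (negPf t0) => /eqP.
have [s sE] := linear_form_at_zero c0 lcc.
have s0 : s != 0 by apply: contraNneq c'0 => s0; rewrite sE s0 scale0r.
have := lc'; rewrite /lg sE !mxE -!scalerA -scalerBr => /eqP.
by rewrite scaler_eq0 (negPf s0) => /eqP.
Qed.

Lemma iter_row_neq0 n F : F != 0 -> ~ indeterminacy_locus F -> iter_row n F != 0.
Proof.
move=> F0 nI; have [j nz] := iter_form_neq0 n F0 nI.
apply: contraNneq nz => e; rewrite -rform_iter_row e -[0](scale0r 0) rformZ.
by rewrite scale0r.
Qed.

End Iterates.
End RationalMaps.

(** * Generic points and orbit cycles *)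

Section Generic.
Variable k : closedFieldType.

Lemma binary_roots e (p : {mpoly k[2]}) : p \is e.-homog -> p != 0 ->
  exists s : seq 'rV[k]_2, (forall c, c \in s -> c != 0) /\
    forall x, x != 0 -> peval p x = 0 -> exists2 c, c \in s & exists t, x = t *: c.
Proof.
elim: e p => [|e IH] p hp p0;
  (have [pu|/nonunit_zero[c c0 pc]] := boolP (p \is a GRing.unit);
   first by exists [::]; split=> // x _ px; move: (unit_peval x pu); rewrite px eqxx).
  case/eqP: p0; apply: peval_all0 => y.
  have := peval_homogZ 0 y hp; have := peval_homogZ 0 c hp.
  by rewrite !scale0r expr0 !mul1r pc => -> ->.
have [q pE hq] := binary_root hp c0 pc.
have [|s [s0 hs]] := IH q hq; first by apply: contraNneq p0 => q0; rewrite pE q0 mulr0.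
exists (c :: s); split=> [z|x x0]; first by rewrite inE => /orP[/eqP->|/s0].
rewrite pE pevalM => /eqP; rewrite mulf_eq0 => /orP[/eqP lx|/eqP /(hs x x0)[z zs h]].
  by exists c; rewrite ?mem_head //; apply: linear_form_at_zero.
by exists z; rewrite // inE zs orbT.
Qed.

(** For a fixed nonzero f0, coprimality means that f1 avoids the finitely many roots of f0, and each
    of these conditions is the nonvanishing of a linear form in the coefficients of f1. This takes
    the place of the resultant. *)
Lemma generic_Rat d (w : {mpoly k[ratdim d]}) : w != 0 ->
  exists2 E : 'rV[k]_(ratdim d), peval w E != 0 & Defs.Rat E.
Proof.
move=> w0; pose X0 : {mpoly k[ratdim d]} := 'X_(lshift d.+1 (ord0 : 'I_d.+1)).
have X00 : X0 != 0 by rewrite -msize_poly_eq0 msizeX.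
have [E1] := peval_neq0 (mulf_neq0 w0 X00).
rewrite pevalM pevalXU mulf_eq0 negb_or => /andP[wE a0].
set a := lsubmx E1; have {}a0 : bform a != 0.
  apply: contraNneq a0 => a0; have := mcoeff_bform a ord0.
  by rewrite a0 mcoeff0 mxE => <-.
have [s [s0 hs]] := binary_roots (dhomog_bform a) a0.
pose wa : {mpoly k[d.+1]} := w \mPo [tuple row_mx (\row_i (a ord0 i)%:MP) (\row_i 'X_i) ord0 l | l < ratdim d].
have waE b : peval wa b = peval w (row_mx a b).
  rewrite peval_comp; congr peval; apply/rowP => l; rewrite mxE tnth_mktuple.
  case: (split_ordP l) => i ->; rewrite ?row_mxEl ?row_mxEr mxE ?pevalC ?pevalXU //.
have wa0 : wa != 0.
  apply: contraNneq wE => h; have := waE (rsubmx E1).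
  by rewrite h peval0 hsubmxK => <-.
pose mv (c : 'rV[k]_2) : 'rV[k]_d.+1 := \row_j peval 'X_[bmonom d j] c.
have mvE c b : peval (lform (mv c)) b = peval (bform b) c.
  rewrite peval_lform peval_sum; apply: eq_bigr => j _.
  by rewrite pevalZ mxE mulrC.
have mv0 c : c != 0 -> mv c != 0.
  move=> c0; apply: contraNneq c0 => h; apply/eqP/rowP => i; rewrite mxE.
  have := mvE c (brow d ('X_i ^+ d)); rewrite h browK; last first.
    by rewrite mpolyXn dhomogX /= mdegMn mdeg1 mul1n.
  have -> : lform (0 : 'rV[k]_d.+1) = 0 by apply/eqP; rewrite lform_eq0.
  by rewrite peval0 pevalXn pevalXU => /esym/eqP; rewrite expf_eq0 => /andP[_ /eqP].
have [b] : exists b, peval (wa * \prod_(c <- s) lform (mv c)) b != 0.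
  apply: peval_neq0; rewrite mulf_neq0 // prodf_seq_neq0; apply/allP => c cs /=.
  by rewrite lform_eq0 mv0 ?s0.
rewrite pevalM mulf_eq0 negb_or waE peval_prod => /andP[wb sb].
exists (row_mx a b) => //; apply/RatP => x x0; apply/eqP => ex.
have rl j : peval (rform (row_mx a b : 'rV_(ratdim d)) j) x = 0.
  by have := congr1 (fun z : 'rV_2 => z ord0 j) ex; rewrite !mxE.
have := rl ord0; have := rl ord_max; rewrite /rform /= row_mxKl row_mxKr => bx ax.
have [c cs [t xE]] := hs x x0 ax.
have t0 : t != 0 by apply: contraNneq x0 => t0; rewrite xE t0 scale0r.
case/eqP: sb; rewrite (big_rem c) //= mvE.
move/eqP: bx; rewrite xE (peval_homogZ _ _ (dhomog_bform b)) mulf_eq0 expf_eq0.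
by rewrite (negPf t0) andbF => /eqP->; rewrite mul0r.
Qed.

Lemma pclosed_form N e (R : {mpoly k[N]}) : R \is e.-homog ->
  pclosed (fun x => x != 0 /\ peval R x = 0).
Proof.
move=> hR; exists (fun Q => Q = R); split=> [Q ->|x]; first by exists e.
by split=> -[x0 h]; split=> //; [move=> Q -> | apply: h].
Qed.

Lemma dense_open_form N (W : pset k N.+1) : dense_open_in (@pspace k N.+1) W ->
  exists2 w : {mpoly k[N.+1]}, w != 0 & forall x, x != 0 -> peval w x != 0 -> W x.
Proof.
move=> [[C [S [hS hC]] WE] dW].
have [x [Wx]] : exists x, W x /\ x != 0.
  apply: NNPP => no; pose v : 'rV[k]_N.+1 := const_mx 1.
  have v0 : v != 0 by apply/eqP => /rowP/(_ ord0)/eqP; rewrite !mxE oner_eq0.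
  have h1 : (1 : {mpoly k[N.+1]}) \is 0.-homog by apply: dhomog1.
  (* The constant 1 cuts out the empty set, which is therefore closed; an empty W could not be
     dense. *)
  have cl1 := pclosed_form h1.
  have [|_ /eqP] := dW v v0 _ cl1; last by rewrite peval1 oner_eq0.
  by move=> x Wx; case: no; exists x; split=> //; case/WE: Wx.
move=> x0; have [_ nCx] := proj1 (WE x) Wx.
have [Q SQ Qx] : exists2 Q, S Q & peval Q x != 0.
  apply: NNPP => no; apply: nCx; apply/hC; split=> // Q SQ.
  by apply/eqP/negPn/negP => Qx; apply: no; exists Q.
exists Q; first by apply: contraNneq Qx => ->; rewrite peval0.
move=> y y0 Qy; apply/WE; split=> // /hC[_ /(_ Q SQ) h].
by rewrite h eqxx in Qy.
Qed.

Lemma homog_peq N e (R : {mpoly k[N]}) x y : R \is e.-homog -> peq x y ->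
  (peval R x == 0) = (peval R y == 0).
Proof.
move=> hR [_ _ [c c0 ->]]; rewrite (peval_homogZ _ _ hR) mulf_eq0 expf_eq0.
by rewrite (negPf c0) andbF.
Qed.

Lemma coef_rowZ (r N e : nat) c (R : {mpoly k[r.+1 * N]}) :
  coef_row e (c *: R) = c *: coef_row e R.
Proof. by apply/rowP => i; rewrite !mxE mcoeffZ. Qed.

Section Orbits.
Variables (d e : nat).
Implicit Types (E : 'rV[k]_(ratdim d)).

(** Freeness gives multiplicity 1, so the form of the orbit cycle is irreducible rather than a
    power. *)
Lemma orbit_chow_form E (p : 'rV[k]_(chow_ncoord 3 (ratdim d) e)) :
  (forall g, stabilizes E g -> pgl_eq g 1%:M) -> orbit_chow_point E p ->
  exists2 R : {mpoly k[4 * ratdim d]},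
    is_chow_form (r := 3) (pclosure (pgl_orbit E)) R & peq p (coef_row (r := 3) e R).
Proof.
move=> free [_ [s [t [st tinj _]] ->]] [[/= Zc _] [Rs [/= hRs hR pE]]].
have s1 : s = 1%N.
  have [s0 _ _] := Zc ord0.
  case: s t st tinj s0 {Zc hR pE} => [|[|s]] t st tinj // _.
  have [c c0 E0] := free _ (st ord0); have [c' c'0 E1] := free _ (st ord_max).
  suff /tinj/(congr1 val) : pgl_eq (t ord0) (t ord_max) by [].
  exists (c / c'); first by rewrite mulf_neq0 ?invr_eq0.
  by rewrite E0 E1 scalerA divfK.
exists (Rs ord0); first exact: hRs.
by move: pE; rewrite s1 big_ord1 expr1.
Qed.

(** Makes it possible to identify the Chow point given by the family on U with the one given by
    [represents_Psi]. *)
Lemma orbit_chow_uniq E (p q : 'rV[k]_(chow_ncoord 3 (ratdim d) e)) :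
  (forall g, stabilizes E g -> pgl_eq g 1%:M) ->
  orbit_chow_point E p -> orbit_chow_point E q -> peq p q.
Proof.
move=> free /(orbit_chow_form free)[R [iR zR] pR] /(orbit_chow_form free)[S [iS zS] qS].
have RS x : peval R x = 0 <-> peval S x = 0.
  have := zR (vec_mx x); have := zS (vec_mx x); rewrite /meval_mx vec_mxK.
  by move=> -> ->.
have [c c0 SE] := irreducible_same_zeros iR iS RS.
have [_ R0 _] := pR.
apply: (peq_trans pR); apply: peq_sym; apply: (peq_trans qS).
by rewrite SE coef_rowZ; apply: (peqP c0).
Qed.

Lemma orbit_chow_supp E (p : 'rV[k]_(chow_ncoord 3 (ratdim d) e)) :
  orbit_chow_point E p -> exists2 Z, chow_point Z p &
    forall x, csupp Z x <-> pclosure (pgl_orbit E) x.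
Proof.
move=> [Z [s _ ZE] hZ]; exists Z => // x; rewrite ZE.
by split=> [[i h]|h] //; exists ord0.
Qed.

End Orbits.

(** Iteration commutes with conjugation, so Q maps the orbit of E into that of E'. The vanishing
    extends to the closure because [pull] is homogeneous. *)
Lemma pull_orbit0 d n e e' D (Q : 'I_(ratdim (d ^ n)) -> {mpoly k[ratdim d]})
    (E : 'rV[k]_(ratdim d)) (E' : 'rV[k]_(ratdim (d ^ n)))
    (p : 'rV[k]_(chow_ncoord 3 (ratdim d) e))
    (p' : 'rV[k]_(chow_ncoord 3 (ratdim (d ^ n)) e')) u w x :
  (forall l, Q l \is D.-homog) -> (forall F, forms_at Q F = iter_row n F) ->
  is_iterate E E' -> orbit_chow_point E' p' ->
  pclosure (pgl_orbit E) x -> peval (pull (r := 3) u w Q (chow_poly p')) x = 0.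
Proof.
move=> hQ QE it /orbit_chow_supp[Z' hZ' Z'E] Ex.
have [_ hp' _ zp'] := chow_pointP hZ'.
have hB := dhomog_pull u w hQ hp'.
suff [] : x != 0 /\ peval (pull (r := 3) u w Q (chow_poly p')) x = 0 by [].
apply: (Ex _ (pclosed_form hB)) => z [g gu zE].
split; first by case: zE.
have V'Q : csupp Z' (forms_at Q (conj_act g E)).
  apply/Z'E => V _; apply; exists g => //; rewrite QE.
  have itg := is_iterate_conj gu it.
  apply: is_iterate_uniq itg; apply: is_iterate_iter_row.
  by apply: Rat_conj => //; case: it.
apply/eqP; rewrite (homog_peq hB zE); apply/eqP; apply: pull_zero zp' _ _; last by right.
by exists (forms_at Q (conj_act g E)).
Qed.

End Generic.

Theorem corollary1p3
  (k : closedFieldType) (hchar : [pchar k] =i pred0)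
  (d n : nat) (hd : (2 <= d)%N) (hn : (2 <= n)%N)
  (e e' : nat) (U : pset k (ratdim d)) (U' : pset k (ratdim (d ^ n)))
  (hU : free_family e U) (hU' : free_family e' U')
  (D : pset k (chow_ncoord 3 (ratdim d) e))
  (Psi : 'rV[k]_(chow_ncoord 3 (ratdim d) e) ->
         'rV[k]_(chow_ncoord 3 (ratdim (d ^ n)) e'))
  (hPsi : represents_Psi U U' D Psi)
  (Z : alg_cycle k (ratdim d)) (Z' : alg_cycle k (ratdim (d ^ n)))
  (p : 'rV[k]_(chow_ncoord 3 (ratdim d) e))
  (p' : 'rV[k]_(chow_ncoord 3 (ratdim (d ^ n)) e'))
  (hZ : chow_point Z p) (hZ' : chow_point Z' p')
  (hGamma : graph_variety U U' D Psi p p')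
  (F : 'rV[k]_(ratdim d)) (hF0 : F != 0) (hF : ~ indeterminacy_locus F)
  (hFZ : csupp Z F) :
  exists2 F' : 'rV[k]_(ratdim (d ^ n)), Phi_value F F' & csupp Z' F'.
Proof.
have [Q [D0 [hQ QE]]] := @iter_row_forms k d n.
have y0 : forms_at Q F != 0 by rewrite QE iter_row_neq0.
exists (forms_at Q F).
  exists Q, D0; split=> //; first exact: peq_refl.
  by move=> E hE _; rewrite QE; apply: is_iterate_iter_row.
apply: NNPP => nZ'.
have [p0 hp zp0 zp] := chow_pointP hZ; have [p'0 hp' zp'0 zp'] := chow_pointP hZ'.
have [e1 [W [hW Wpp' W0]]] := separating_biform hchar hQ zp0 zp zp'0 hp' zp'
  (fun x => @csupp_neq0 _ _ _ _ _ _ x hZ') (fun c x => @csupp_scale _ _ _ _ _ _ c x hZ')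
  hFZ hF0 y0 nZ'.
have [_ _ hcl] := hGamma.
suff [_ _ /eqP] : [/\ p != 0, p' != 0 & W p p' = 0] by rewrite (negPf Wpp').
have [QW hQW WE] := hW.
apply: (hcl (fun x y => [/\ x != 0, y != 0 & W x y = 0])).
  exists (fun q => q = QW); split=> [q ->|x y]; first by exists e1, 1%N.
  by rewrite WE; split=> -[x0 z0 h]; split=> //; [move=> Q1 -> | apply: h].
(* W has to vanish over all of D, while it is known to vanish only at the orbit cycles of generic E.
   A value W(q, q') <> 0 is therefore transported from q to such an E. *)
move=> q q' [Dq [Pq0 q'0 [c c0 Pq]]].
have [[[DC clDC DE] _] regD _ [W1 dW1 hW1]] := hPsi.
have [[[Zq hZq] clq] _] := proj1 (DE q) Dq.
have [q0 _ _ _] := chow_pointP hZq.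
split=> //; apply/eqP/negPn/negP => Wq.
have {}Wq : W q (Psi q) != 0.
  by rewrite Pq (biform_scale_r _ _ _ hW) expr1 mulf_neq0.
have [P [eP [hP Pq1 PPsi]]] := regD q Dq.
(* R(x) is W(x, Psi(x)) up to a nonzero factor wherever the local formula P is valid. *)
have [R hR RE] := biform_subst hW hP.
have Rq : peval R q != 0.
  have [_ _ [b b0 Eb]] := PPsi q Dq Pq1.
  by move: Wq; rewrite RE Eb (biform_scale_r _ _ _ hW) mulf_eq0 negb_or => /andP[].
have [dU Uinv Ufree [f regf fU]] := hU.
(* Otherwise the zero set of R would contain the closure of the orbit points, hence q. *)
have [q1 [E1 [UE1 q1E] Rq1]] : exists q1, exists2 E1, U E1 /\ orbit_chow_point E1 q1 & peval R q1 != 0.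
  apply: NNPP => no; have [|_ h] := clq _ (pclosed_form hR); last by rewrite h eqxx in Rq.
  move=> x [E1 UE1 xE]; split; first by case: xE => ? _ /chow_pointP[].
  by apply/eqP/negPn/negP => Rx; apply: no; exists x, E1.
have [T [eT [hT T1 fT]]] := regf E1 UE1.
pose RT := R \mPo [tuple T l | l < _].
have RTE x : peval RT x = peval R (forms_at T x).
  by rewrite peval_comp; congr peval; apply/rowP => l; rewrite !mxE tnth_mktuple.
have [l Tl] : exists l, peval (T l) E1 != 0.
  apply: NNPP => no; case/eqP: T1; apply/rowP => l; rewrite !mxE.
  by apply/eqP/negPn/negP => h; apply: no; exists l.
have RT1 : peval RT E1 != 0.
  rewrite RTE -(homog_peq hR (fT _ UE1 T1)).
  by rewrite -(homog_peq hR (orbit_chow_uniq (Ufree _ ^~ UE1) q1E (fU _ UE1))).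
have [w1 w10 w1W] := dense_open_form dW1; have [w2 w20 w2U] := dense_open_form dU.
(* RT keeps R nonzero at the Chow point of E, T_l makes the local formula T valid at E, w1 gives the
   description of [Psi] at E, and w2 puts E in U. *)
have [E] : exists2 E, peval (RT * T l * (w1 * w2)) E != 0 & Defs.Rat E.
  apply: generic_Rat; rewrite !mulf_neq0 //.
    by apply: contraNneq RT1 => ->; rewrite peval0.
  by apply: contraNneq Tl => ->; rewrite peval0.
rewrite !pevalM !mulf_eq0 !negb_or => /andP[/andP[RTx Tx] /andP[w1x w2x]] ratE.
have E0 := Rat_neq0 ratE; have UE := w2U _ E0 w2x.
have [E' [pE [pE' [[Q' [e2 [hQ' E'E itQ']]] pEE pEE' DpE PsiE]]]] := hW1 _ (w1W _ E0 w1x).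
have it : is_iterate E E'.
  by apply: (is_iterate_peq _ E'E); apply: itQ' => //; case: (E'E).
have TE : forms_at T E != 0.
  by apply: contraNneq Tx => h; have := congr1 (fun z : 'rV_ _ => z ord0 l) h; rewrite !mxE => ->.
have RpE : peval R pE != 0.
  rewrite (homog_peq hR (orbit_chow_uniq (fun g => Ufree _ g UE) pEE (fU _ UE))).
  by rewrite (homog_peq hR (fT _ UE TE)) -RTE.
have WpE : W pE pE' = 0.
  have [ZE hZE ZEE] := orbit_chow_supp pEE.
  have [ZE' hZE' _] := orbit_chow_supp pEE'.
  have [_ _ _ zE] := chow_pointP hZE; have [_ hE' _ _] := chow_pointP hZE'.
  apply: W0 zE _ hE' _ => [x /(csupp_neq0 hZE) //|u w x /ZEE].
  exact: (pull_orbit0 (e := e)) hQ QE it pEE'.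
(* W is linear in its second argument, so P = 0 would give R = 0; hence P does compute [Psi] at this
   point. *)
have PpE : forms_at P pE != 0.
  apply: contraNneq RpE => h; rewrite RE h -(scale0r 0) (biform_scale_r _ _ _ hW).
  by rewrite expr1 mul0r.
have [_ _ [a a0 Ea]] := peq_trans (peq_sym (PPsi _ DpE PpE)) PsiE.
by case/eqP: RpE; rewrite RE Ea (biform_scale_r _ _ _ hW) WpE mulr0.
Qed.
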